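(* Let $R$ be a Noetherian ring, $X_1,\dots,X_n$ indeterminates over $R$, $P$ a prime ideal of $R[X_1,\dots,X_n]$ and $p:=P\cap R$. Then $$\operatorname{edim}\big(R[X_1,\dots,X_n]_P\big)=\operatorname{edim}(R_p)+\operatorname{ht}\Big(\frac{P}{p[X_1,\dots,X_n]}\Big)=\operatorname{edim}(R_p)+\operatorname{edim}\Big(\kappa_R(p)[X_1,\dots,X_n]_{\frac{P_p}{pR_p[X_1,\dots,X_n]}}\Big).$$
   Context: $\operatorname{edim}$ of a Noetherian local ring $(S,\mathfrak s)$ is $\dim_{S/\mathfrak s}(\mathfrak s/\mathfrak s^2)$. $\operatorname{ht}(P/p[X_1,\dots,X_n])$ is the height of the prime $P/p[X_1,\dots,X_n]$ in $(R/p)[X_1,\dots,X_n]$. $\kappa_R(p)=R_p/pR_p$ is the residue field, $P_p=PR_p[X_1,\dots,X_n]$, and $P_p/pR_p[X_1,\dots,X_n]$ is the corresponding prime of $\kappa_R(p)[X_1,\dots,X_n]\cong R_p[X_1,\dots,X_n]/pR_p[X_1,\dots,X_n]$. *)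

(* Defs.v *)
From HB Require Import structures.
From mathcomp Require Import all_boot all_order all_algebra.
From mathcomp Require Import boolp.
From mathcomp Require Import ring.
From mathcomp Require Import mpoly.

Set Implicit Arguments.
Unset Strict Implicit.
Unset Printing Implicit Defensive.

Import GRing.Theory.
Local Open Scope ring_scope.
Local Open Scope quotient_scope.

Definition is_ideal (A : comNzRingType) (I : A -> Prop) : Prop :=
  [/\ I 0, (forall x y, I x -> I y -> I (x + y)) & (forall a x, I x -> I (a * x))].

Definition is_prime_ideal (A : comNzRingType) (I : A -> Prop) : Prop :=
  [/\ is_ideal I, ~ I 1 & (forall x y, I (x * y) -> I x \/ I y)].

Section Localization.
Variables (A : comNzRingType) (P : A -> Prop) (hP : is_prime_ideal P).

Lemma nP1 : ~ P 1. Proof. by case: hP. Qed.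
Lemma nPM a b : ~ P a -> ~ P b -> ~ P (a * b).
Proof. by case: hP => _ _ h na nb /h [] . Qed.

Definition lpair := {x : A * A | `[< ~ P x.2 >]}.
Definition lnum (x : lpair) := (val x).1.
Definition lden (x : lpair) := (val x).2.
Lemma ldenP (x : lpair) : ~ P (lden x).
Proof. exact: asboolW (valP x). Qed.
Arguments ldenP : clear implicits.

Definition lrel : rel lpair := fun x y => let _ := hP in
  `[< exists2 u, ~ P u & u * (lnum x * lden y - lnum y * lden x) = 0 >].

Lemma lrelP x y : reflect (exists2 u, ~ P u & u * (lnum x * lden y - lnum y * lden x) = 0) (lrel x y).
Proof. exact: asboolP. Qed.

Lemma lrel_is_equiv : equiv_class_of lrel.
Proof.
split=> [x|x y|y x z].
- by apply/lrelP; exists 1; [exact: nP1| rewrite subrr mulr0].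
- apply/lrelP/lrelP => -[u nu hu]; exists u => //;
  by rewrite -[LHS]opprK -mulrN opprB hu oppr0.
- move=> /lrelP [u nu hu] /lrelP [v nv hv]; apply/lrelP.
  exists (u * v * lden y); first exact: nPM (nPM nu nv) (ldenP y).
  have -> : u * v * lden y * (lnum x * lden z - lnum z * lden x) =
    v * lden z * (u * (lnum x * lden y - lnum y * lden x)) +
    u * lden x * (v * (lnum y * lden z - lnum z * lden y)) by ring.
  by rewrite hu hv !mulr0 addr0.
Qed.

Canonical lrel_equiv := EquivRelPack lrel_is_equiv.
Canonical lrel_encModRel := defaultEncModRel lrel.

Definition loc := {eq_quot lrel}.
HB.instance Definition _ : EqQuotient lpair lrel loc := EqQuotient.on loc.
HB.instance Definition _ := Choice.on loc.

Definition mkl (a s : A) (hs : ~ P s) : lpair := exist _ (a, s) (asboolT hs).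

Definition ladd (x y : lpair) := mkl (lnum x * lden y + lnum y * lden x) (nPM (ldenP x) (ldenP y)).
Definition lopp (x : lpair) := mkl (- lnum x) (ldenP x).
Definition lmul (x y : lpair) := mkl (lnum x * lnum y) (nPM (ldenP x) (ldenP y)).
Definition l0 := mkl 0 nP1.
Definition l1 := mkl 1 nP1.

Lemma lrelE x y : (x == y %[mod loc]) = lrel x y.
Proof. by rewrite piE. Qed.

Lemma eqlP x y : reflect (exists2 u, ~ P u & u * (lnum x * lden y - lnum y * lden x) = 0)
   (x == y %[mod loc]).
Proof. by rewrite lrelE; apply: lrelP. Qed.

Definition zero : loc := lift_cst loc l0.
Definition one : loc := lift_cst loc l1.
Definition add := lift_op2 loc ladd.
Definition opp := lift_op1 loc lopp.
Definition mul := lift_op2 loc lmul.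

Canonical pi_zero_morph := PiConst zero.
Canonical pi_one_morph := PiConst one.

Lemma pi_opp : {morph \pi : x / lopp x >-> opp x}.
Proof.
move=> x; unlock opp; apply/eqP/eqlP.
have /eqlP [u nu hu] : repr (\pi_loc x) == x %[mod loc] by rewrite reprK.
set x' := repr _ in hu *.
exists u => //.
rewrite /lopp /lnum /lden /= -/(lnum x) -/(lden x) -/(lnum x') -/(lden x').
have -> : u * (- lnum x * lden x' - - lnum x' * lden x) =
  u * (lnum x' * lden x - lnum x * lden x') by ring.
by rewrite hu.
Qed.
Canonical pi_opp_morph := PiMorph1 pi_opp.

Lemma pi_add : {morph \pi : x y / ladd x y >-> add x y}.
Proof.
move=> x y; unlock add; apply/eqP/eqlP.
have /eqlP [u nu hu] : repr (\pi_loc x) == x %[mod loc] by rewrite reprK.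
have /eqlP [v nv hv] : repr (\pi_loc y) == y %[mod loc] by rewrite reprK.
set x' := repr _ in hu *; set y' := repr _ in hv *.
exists (u * v); first exact: nPM.
rewrite /ladd /lnum /lden /= -/(lnum x) -/(lnum y) -/(lden x) -/(lden y)
   -/(lnum x') -/(lnum y') -/(lden x') -/(lden y').
have -> : u * v * ((lnum x * lden y + lnum y * lden x) * (lden x' * lden y') -
   (lnum x' * lden y' + lnum y' * lden x') * (lden x * lden y)) =
   - (v * lden y' * lden y * (u * (lnum x' * lden x - lnum x * lden x')) +
   u * lden x' * lden x * (v * (lnum y' * lden y - lnum y * lden y'))) by ring.
by rewrite hu hv !mulr0 addr0 oppr0.
Qed.
Canonical pi_add_morph := PiMorph2 pi_add.

Lemma pi_mul : {morph \pi : x y / lmul x y >-> mul x y}.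
Proof.
move=> x y; unlock mul; apply/eqP/eqlP.
have /eqlP [u nu hu] : repr (\pi_loc x) == x %[mod loc] by rewrite reprK.
have /eqlP [v nv hv] : repr (\pi_loc y) == y %[mod loc] by rewrite reprK.
set x' := repr _ in hu *; set y' := repr _ in hv *.
exists (u * v); first exact: nPM.
rewrite /lmul /lnum /lden /= -/(lnum x) -/(lnum y) -/(lden x) -/(lden y)
   -/(lnum x') -/(lnum y') -/(lden x') -/(lden y').
have -> : u * v * (lnum x * lnum y * (lden x' * lden y') -
   lnum x' * lnum y' * (lden x * lden y)) =
   - (v * lnum y' * lden y * (u * (lnum x' * lden x - lnum x * lden x')) +
   u * lnum x * lden x' * (v * (lnum y' * lden y - lnum y * lden y'))) by ring.
by rewrite hu hv !mulr0 addr0 oppr0.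
Qed.
Canonical pi_mul_morph := PiMorph2 pi_mul.

Ltac lsolve := apply/eqP/eqlP; exists 1; [exact: nP1|]; rewrite /ladd /lopp /lmul /l0 /l1 /mkl /lnum /lden /=; ring.

Lemma addqA : associative add.
Proof. by move=> x y z; rewrite -[x]reprK -[y]reprK -[z]reprK !piE; lsolve. Qed.
Lemma addqC : commutative add.
Proof. by move=> x y; rewrite -[x]reprK -[y]reprK !piE; lsolve. Qed.
Lemma add0q : left_id zero add.
Proof. by move=> x; rewrite -[x]reprK !piE; lsolve. Qed.
Lemma addNq : left_inverse zero opp add.
Proof. by move=> x; rewrite -[x]reprK !piE; lsolve. Qed.

HB.instance Definition _ := GRing.isZmodule.Build loc addqA addqC add0q addNq.

Lemma mulqA : associative mul.
Proof. by move=> x y z; rewrite -[x]reprK -[y]reprK -[z]reprK !piE; lsolve. Qed.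
Lemma mulqC : commutative mul.
Proof. by move=> x y; rewrite -[x]reprK -[y]reprK !piE; lsolve. Qed.
Lemma mul1q : left_id one mul.
Proof. by move=> x; rewrite -[x]reprK !piE; lsolve. Qed.
Lemma mulq_addl : left_distributive mul (@GRing.add _).
Proof.
move=> x y z; rewrite -[x]reprK -[y]reprK -[z]reprK /GRing.add /=.
by rewrite !piE; lsolve.
Qed.
Lemma nonzero1q : one != 0.
Proof.
apply/eqP => h.
have e1 : \pi_loc l1 = one by rewrite piE.
have e0 : \pi_loc l0 = zero by rewrite piE.
have : l1 == l0 %[mod loc] by apply/eqP; rewrite e1 e0; exact: h.
move/eqlP => [u nu]; rewrite /l1 /l0 /mkl /lnum /lden /= => hu.
apply: nu; have -> : u = u * (1 * 1 - 0 * 1) by ring.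
by rewrite hu; case: hP => -[].
Qed.

HB.instance Definition _ := GRing.Zmodule_isComNzRing.Build loc
  mulqA mulqC mul1q mulq_addl nonzero1q.

Lemma loc_pi0 : \pi_loc l0 = 0. Proof. by rewrite piE. Qed.
Lemma loc_pi1 : \pi_loc l1 = 1. Proof. by rewrite piE. Qed.
Lemma loc_piD x y : \pi_loc (ladd x y) = \pi_loc x + \pi_loc y.
Proof. by rewrite piE. Qed.
Lemma loc_piM x y : \pi_loc (lmul x y) = \pi_loc x * \pi_loc y.
Proof. by rewrite piE. Qed.

End Localization.


Section LocMax.
Variables (A : comNzRingType) (P : A -> Prop) (hP : is_prime_ideal P).

Definition locmax : loc hP -> Prop :=
  fun z => exists x : lpair P, P (lnum x) /\ z = \pi_(loc hP) x.

Lemma locmax_proper : is_ideal locmax /\ ~ locmax 1.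
Proof.
have [[P0 PD PM] P1 Pp] := hP.
split; first split.
- exists (l0 hP); split; first exact: P0.
  by rewrite loc_pi0.
- move=> _ _ [x [Px ->]] [y [Py ->]]; exists (ladd hP x y); split.
    by rewrite /ladd /mkl /lnum /=; apply: PD; [rewrite mulrC; exact: (PM _ _ Px) | rewrite mulrC; exact: (PM _ _ Py)].
  by rewrite loc_piD.
- move=> a _ [x [Px ->]]; exists (lmul hP (repr a) x); split.
    by rewrite /lmul /mkl /lnum /=; exact: (PM _ _ Px).
  by rewrite loc_piM reprK.
- move=> [x [Px e]].
  have e1 := loc_pi1 hP.
  have : l1 hP == x %[mod loc hP] by apply/eqP; rewrite e1 e.
  move/eqlP => [u nu]; rewrite /l1 /mkl /lnum /lden /= => hu.
  have : P (u * (1 * lden x - lnum x * 1)) by rewrite hu.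
  case/Pp => // hd.
  have hd' : P (lden x).
    have -> : lden x = (1 * lden x - lnum x * 1) + lnum x * 1 by ring.
    by apply: PD => //; rewrite mulrC; exact: (PM _ _ Px).
  exact: ldenP x hd'.
Qed.

End LocMax.
Arguments locmax {A P} hP.

Section QuotRing.
Variables (B : comNzRingType) (I : B -> Prop).

Definition ipred (hI : is_ideal I /\ ~ I 1) : {pred B} := fun x => `[< I x >].

Variable hI : is_ideal I /\ ~ I 1.

Lemma ipred_closed : idealr_closed (ipred hI).
Proof.
have [[I0 ID IM] I1] := hI.
split; first exact: asboolT.
  by apply/negP => /asboolW.
by move=> a u v /asboolW hu /asboolW hv; apply: asboolT; apply: ID => //; apply: IM.
Qed.

HB.instance Definition _ := isIdealr.Build B (ipred hI) ipred_closed.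

Definition qring := {ideal_quot (ipred hI)}.
HB.instance Definition _ := GRing.ComNzRing.on qring.
Definition qpi : B -> qring := \pi_qring.

End QuotRing.

Lemma prime_proper (B : comNzRingType) (I : B -> Prop) :
  is_prime_ideal I -> is_ideal I /\ ~ I 1.
Proof. by case. Qed.

Definition contraction (R : comNzRingType) (n : nat) (P : {mpoly R[n]} -> Prop) : R -> Prop :=
  fun r => P r%:MP.

Lemma contraction_prime (R : comNzRingType) (n : nat) (P : {mpoly R[n]} -> Prop) :
  is_prime_ideal P -> is_prime_ideal (contraction P).
Proof.
case=> -[P0 PD PM] P1 Pp; split; first split.
- by rewrite /contraction raddf0.
- by move=> x y hx hy; rewrite /contraction raddfD; apply: PD.
- by move=> a x hx; rewrite /contraction rmorphM; apply: PM.
- by rewrite /contraction rmorph1.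
- by move=> x y; rewrite /contraction rmorphM => /Pp.
Qed.

Definition ideal_fg (A : comNzRingType) (I : A -> Prop) : Prop :=
  exists (k : nat) (g : 'I_k -> A),
    forall x, I x <-> exists c : 'I_k -> A, x = \sum_(i < k) c i * g i.

Definition noetherian (A : comNzRingType) : Prop :=
  forall I : A -> Prop, is_ideal I -> ideal_fg I.

Definition ideal_sq (B : comNzRingType) (m : B -> Prop) : B -> Prop :=
  fun x => exists (k : nat) (y z : 'I_k -> B),
    (forall i, m (y i) /\ m (z i)) /\ x = \sum_(i < k) y i * z i.

Definition cotangent_free (B : comNzRingType) (m : B -> Prop) (k : nat) (x : 'I_k -> B) : Prop :=
  (forall i, m (x i)) /\
  forall c : 'I_k -> B, ideal_sq m (\sum_(i < k) c i * x i) -> forall i, m (c i).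

Definition has_edim (B : comNzRingType) (m : B -> Prop) (d : nat) : Prop :=
  (exists x : 'I_d -> B, cotangent_free m x) /\
  (forall x : 'I_d.+1 -> B, ~ cotangent_free m x).

Definition edim_at (A : comNzRingType) (Q : A -> Prop) (d : nat) : Prop :=
  exists hQ : is_prime_ideal Q, has_edim (locmax hQ) d.

Definition prime_chain (A : comNzRingType) (q : nat -> A -> Prop) (h : nat) : Prop :=
  (forall i, (i <= h)%N -> is_prime_ideal (q i)) /\
  (forall i, (i < h)%N -> (forall x, q i x -> q i.+1 x) /\ exists x, q i.+1 x /\ ~ q i x).

Definition has_height (A : comNzRingType) (Q : A -> Prop) (h : nat) : Prop :=
  (exists q, prime_chain q h /\ forall x, q h x <-> Q x) /\
  ~ (exists q, prime_chain q h.+1 /\ forall x, q h.+1 x <-> Q x).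

Section Residue.
Variables (A : comNzRingType) (p : A -> Prop) (hp : is_prime_ideal p).
Definition residue_field := qring (locmax_proper hp).
HB.instance Definition _ := GRing.ComNzRing.on residue_field.
Definition to_residue (r : A) : residue_field :=
  qpi (locmax_proper hp) (\pi_(loc hp) (mkl r (nP1 hp))).
Definition quot_ring := qring (prime_proper hp).
HB.instance Definition _ := GRing.ComNzRing.on quot_ring.
Definition to_quot (r : A) : quot_ring := qpi (prime_proper hp) r.
End Residue.

Section Fibre.
Variables (R : comNzRingType) (n : nat) (P : {mpoly R[n]} -> Prop) (hP : is_prime_ideal P).
Let hp := contraction_prime hP.

Definition quot_prime : {mpoly (quot_ring hp)[n]} -> Prop :=
  fun f => exists g, P g /\ f = map_mpoly (to_quot hp) g.

Definition fibre_prime : {mpoly (residue_field hp)[n]} -> Prop :=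
  fun f => exists (k : nat) (h : 'I_k -> {mpoly (residue_field hp)[n]}) (g : 'I_k -> {mpoly R[n]}),
    (forall i, P (g i)) /\ f = \sum_(i < k) h i * map_mpoly (to_residue hp) (g i).
End Fibre.
Arguments quot_prime {R n P} hP.
Arguments fibre_prime {R n P} hP.

(* Main.v *)
Require Import Defs.
From HB Require Import structures.
From mathcomp Require Import all_boot all_order all_algebra.
From mathcomp Require Import boolp.
From mathcomp Require Import ring zify.
From mathcomp Require Import mpoly.

(* For a prime [P] of [A[X]] lying over [q], the local ring [A[X]_P] has maximal ideal
   generated by [q], or by [q] and one polynomial [f] of minimal degree in [P] but outside
   [q[X]]; in the second case [f] is independent of a basis of the cotangent space of
   [A_q].  Adjoining the variables one at a time gives [edim R[X]_P = edim R_p + rk P],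
   where [rk P] counts the variables that are algebraic over the preceding ones modulo
   [P].  The count [rk P] does not change when [R] is replaced by [R/p] or by the residue
   field, so it remains to see that it is the height of [P/p[X]].  Extending primes from
   [n] to [n + 1] variables yields a chain of length [rk P].  No chain is longer because
   [rk] is strictly increasing on primes with the same contraction: if [P] is strictly
   contained in [P'], then [n - rk P'] variables independent modulo [P'], together with an
   element of [P'] outside [P], are independent modulo [P], and [k] elements independent
   modulo [P] satisfy [k + rk P <= n].  The last bound compares two orders of adjunction of
   the variables and of the [k] elements; [rk] does not depend on the order since [edim]
   does not. *)

Set Implicit Arguments.
Unset Strict Implicit.
Unset Printing Implicit Defensive.

Import GRing.Theory.
Local Open Scope ring_scope.
Local Open Scope quotient_scope.

(** * Ideals and their squares *)

Section Ideals.
Variables (A : comNzRingType) (I : A -> Prop).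
Hypothesis hI : is_ideal I.

Lemma ideal0 : I 0. Proof. by case: hI. Qed.
Lemma idealD x y : I x -> I y -> I (x + y). Proof. by case: hI => _ h _; apply: h. Qed.
Lemma ideal_mull a x : I x -> I (a * x). Proof. by case: hI => _ _; apply. Qed.
Lemma ideal_mulr x a : I x -> I (x * a). Proof. by rewrite mulrC; apply: ideal_mull. Qed.
Lemma idealN x : I x -> I (- x). Proof. by rewrite -mulN1r; apply: ideal_mull. Qed.
Lemma idealB x y : I x -> I y -> I (x - y).
Proof. by move=> hx hy; apply: idealD => //; apply: idealN. Qed.
Lemma idealBr x y : I (x - y) -> I y -> I x.
Proof. by move=> hx hy; rewrite -(subrK y x); apply: idealD. Qed.
Lemma ideal_sum (T : Type) (r : seq T) (D : pred T) (F : T -> A) :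
  (forall i, D i -> I (F i)) -> I (\sum_(i <- r | D i) F i).
Proof. by move=> h; apply: big_ind => //; [exact: ideal0 | exact: idealD]. Qed.

Lemma ideal_sq_prod x y : I x -> I y -> ideal_sq I (x * y).
Proof.
move=> hx hy; exists 1%N, (fun=> x), (fun=> y); split=> //.
by rewrite big_ord1.
Qed.

Lemma ideal_sq_ideal : is_ideal (ideal_sq I).
Proof.
split.
- by exists 0%N, (fun=> 0), (fun=> 0); split; [case | rewrite big_ord0].
- move=> _ _ [k [y [z [h ->]]]] [k' [y' [z' [h' ->]]]].
  pose glue (u : 'I_k -> A) (u' : 'I_k' -> A) i :=
    match split i with inl j => u j | inr j => u' j end.
  exists (k + k')%N, (glue y y'), (glue z z'); split.
    by move=> i; rewrite /glue; case: split.
  rewrite big_split_ord; congr (_ + _); apply: eq_bigr => i _; rewrite /glue.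
    by rewrite (unsplitK (inl i)).
  by rewrite (unsplitK (inr i)).
- move=> a _ [k [y [z [h ->]]]].
  exists k, (fun i => a * y i), z; split.
    by move=> i; case: (h i) => hy hz; split=> //; apply: ideal_mull.
  by rewrite mulr_sumr; apply: eq_bigr => i _; rewrite mulrA.
Qed.

Lemma ideal_sq_min (J : A -> Prop) : is_ideal J ->
  (forall x y, I x -> I y -> J (x * y)) -> forall z, ideal_sq I z -> J z.
Proof.
move=> [J0 JD _] hJ _ [k [y [z [h ->]]]].
by apply: big_ind => // i _; case: (h i); apply: hJ.
Qed.

Lemma ideal_sq_sub z : ideal_sq I z -> I z.
Proof. by apply: ideal_sq_min => // x y hx _; apply: ideal_mulr. Qed.

End Ideals.

(** * Prime ideals and linear dependence modulo a prime *)

Section PrimeIdeals.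
Variables (A : comNzRingType) (Q : A -> Prop).
Hypothesis hQ : is_prime_ideal Q.

Lemma prime_ideal : is_ideal Q. Proof. by case: hQ. Qed.
Lemma prime1 : ~ Q 1. Proof. by case: hQ. Qed.
Lemma primeM x y : Q (x * y) -> Q x \/ Q y. Proof. by case: hQ => _ _; apply. Qed.
Lemma primeMl x y : ~ Q x -> Q (x * y) -> Q y. Proof. by move=> nx /primeM []. Qed.
Lemma primeMr x y : ~ Q y -> Q (x * y) -> Q x. Proof. by move=> nx /primeM []. Qed.
Lemma nprimeM x y : ~ Q x -> ~ Q y -> ~ Q (x * y).
Proof. by move=> nx ny /primeM []. Qed.
Lemma nprimeX x k : ~ Q x -> ~ Q (x ^+ k).
Proof.
by move=> nx; elim: k => [|k IH]; [rewrite expr0; exact: prime1 | rewrite exprS; apply: nprimeM].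
Qed.

(* Gaussian elimination over the domain [A / Q], with denominators cleared. *)
Lemma dependent_rows d k (M : 'I_k -> 'I_d -> A) : (d < k)%N ->
  exists c : 'I_k -> A, (exists i, ~ Q (c i)) /\
    forall j, Q (\sum_i c i * M i j).
Proof.
elim: d k M => [|d IH] k M ltdk.
  by exists (fun=> 1); split; [exists (Ordinal ltdk); exact: prime1 | case].
case: (pselect (exists i0, ~ Q (M i0 ord0))) => [[i0 n0]|h0]; last first.
  have [|c [hc hM]] := IH k (fun i j => M i (lift ord0 j)); first exact: ltnW.
  exists c; split=> // j; case: (unliftP ord0 j) => [j' ->|->]; first exact: hM.
  apply: ideal_sum; first exact: prime_ideal.
  move=> i _; apply: (ideal_mull prime_ideal); apply: contrapT => ni.
  by apply: h0; exists i.
case: k => [//|k] in M i0 n0 ltdk *.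
pose M' i j := M i0 ord0 * M (lift i0 i) (lift ord0 j)
              - M (lift i0 i) ord0 * M i0 (lift ord0 j).
have [|c [[i1 hc] hM]] := IH k M'; first by [].
(* The coefficient of the pivot row [i0] is chosen so that the combination vanishes in column 0. *)
pose c' i := match unlift i0 i with
  | Some i' => M i0 ord0 * c i'
  | None => - \sum_i' c i' * M (lift i0 i') ord0 end.
have c'E j : \sum_i c' i * M i j = \sum_i c i *
   (M i0 ord0 * M (lift i0 i) j - M (lift i0 i) ord0 * M i0 j).
  rewrite (bigD1_ord i0) //= {1}/c' unlift_none mulNr mulr_suml -sumrN -big_split /=.
  by apply: eq_bigr => i _; rewrite /c' liftK; ring.
exists c'; split.
  by exists (lift i0 i1); rewrite /c' liftK; apply: nprimeM.
move=> j; rewrite c'E; case: (unliftP ord0 j) => [j' ->|->]; first exact: hM.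
rewrite big1; first exact: (ideal0 prime_ideal).
by move=> i _; ring.
Qed.

End PrimeIdeals.

(** * Bases of the cotangent space at a prime *)

Definition cot_spans (A : comNzRingType) (Q : A -> Prop) d (x : 'I_d -> A) :=
  forall y, Q y -> exists u c, ~ Q u /\ ideal_sq Q (u * y - \sum_i c i * x i).

Definition cot_free (A : comNzRingType) (Q : A -> Prop) d (x : 'I_d -> A) :=
  forall u c, ~ Q u -> ideal_sq Q (u * \sum_i c i * x i) -> forall i, Q (c i).

(* Equivalently, the images of [x] form a basis of the cotangent space of [A_Q]; in
   [cot_free] and [cot_spans] the denominators [u] have been cleared. *)
Definition cot_basis (A : comNzRingType) (Q : A -> Prop) d (x : 'I_d -> A) :=
  [/\ forall i, Q (x i), cot_free Q x & cot_spans Q x].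

Section CotangentBasis.
Variables (A : comNzRingType) (Q : A -> Prop).
Hypothesis hQ : is_prime_ideal Q.
Let iQ := prime_ideal hQ.
Let iQ2 := ideal_sq_ideal iQ.

(** Steinitz bound: if [k > d], the coordinate rows of the [x i] with respect to [g] are dependent
    modulo [Q], and the same coefficients, times the denominators, give a relation among the [x i]
    modulo the square of [Q]. *)
Lemma cot_free_le k d (x : 'I_k -> A) (g : 'I_d -> A) :
  (forall i, Q (x i)) -> (forall j, Q (g j)) ->
  cot_free Q x -> cot_spans Q g -> (k <= d)%N.
Proof.
move=> Qx Qg fx sg; rewrite leqNgt; apply/negP => ltdk.
have /choice [uc huc] : forall i, exists uc : A * ('I_d -> A), ~ Q uc.1 /\
    ideal_sq Q (uc.1 * x i - \sum_j uc.2 j * g j).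
  by move=> i; have [u [c h]] := sg _ (Qx i); exists (u, c).
have [c [[i0 n0] hc]] := dependent_rows hQ (fun i => (uc i).2) ltdk.
have := fx 1 (fun i => c i * (uc i).1) (prime1 hQ).
move=> /(_ _ i0) => h; apply: (nprimeM hQ n0 (huc i0).1); apply: h.
rewrite mul1r; apply: (idealBr iQ2 (y := \sum_j (\sum_i c i * (uc i).2 j) * g j)).
  under [X in _ - X]eq_bigr => j _ do rewrite mulr_suml.
  rewrite exchange_big /= -sumrB; apply: (ideal_sum iQ2) => i _.
  under eq_bigr => j _ do rewrite -mulrA.
  rewrite -mulr_sumr -mulrA -mulrBr; apply: (ideal_mull iQ2); exact: (huc i).2.
by apply: (ideal_sum iQ2) => j _; apply: ideal_sq_prod => //; apply: hc.
Qed.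

Lemma cot_basis_size k d (x : 'I_k -> A) (y : 'I_d -> A) :
  cot_basis Q x -> cot_basis Q y -> k = d.
Proof.
move=> [Qx fx sx] [Qy fy sy]; apply/eqP; rewrite eqn_leq.
by rewrite (cot_free_le Qx Qy fx sy) (cot_free_le Qy Qx fy sx).
Qed.

(** A spanning family of minimal size is free: an element whose coefficient in some relation lies
    outside [Q] could be dropped. *)
Lemma cot_basis_exists : ideal_fg Q -> exists d (x : 'I_d -> A), cot_basis Q x.
Proof.
move=> [k [g hg]].
pose S d := `[< exists x : 'I_d -> A, (forall i, Q (x i)) /\ cot_spans Q x >].
have : exists d, S d.
  exists k; apply/asboolP; exists g; split.
    move=> i; apply/hg; exists (fun j => (j == i)%:R).
    rewrite (bigD1 i) //= eqxx mul1r big1 ?addr0 // => j /negbTE ->.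
    by rewrite mul0r.
  move=> y /hg [c ->]; exists 1, c; split; first exact: prime1.
  by rewrite mul1r subrr; apply: ideal0.
case/ex_minnP => d /asboolP [x [Qx sx]] hmin.
exists d, x; split=> // w c nw hc i0; apply: contrapT => n0.
case: d => [|d] in x Qx sx c hc i0 n0 hmin *; first by case: i0 {n0}.
suff /hmin : S d by rewrite ltnn.
apply/asboolP; exists (fun i => x (lift i0 i)); split=> // y /sx [u [b [nu hb]]].
(* These coefficients eliminate [x i0] between the expression of [y] and the relation with
   coefficients [c]. *)
exists (w * c i0 * u), (fun i => w * (c i0 * b (lift i0 i) - b i0 * c (lift i0 i))).
split; first by do !apply: nprimeM.
have -> : w * c i0 * u * y
    - \sum_i w * (c i0 * b (lift i0 i) - b i0 * c (lift i0 i)) * x (lift i0 i)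
  = w * c i0 * (u * y - \sum_i b i * x i) + b i0 * (w * \sum_i c i * x i).
  rewrite !(bigD1_ord i0 (P := xpredT)) //=.
  have -> : \sum_i w * (c i0 * b (lift i0 i) - b i0 * c (lift i0 i)) * x (lift i0 i)
     = w * c i0 * (\sum_i b (lift i0 i) * x (lift i0 i))
       - w * b i0 * (\sum_i c (lift i0 i) * x (lift i0 i)).
    by rewrite !mulr_sumr -sumrB; apply: eq_bigr => i _; ring.
  by ring.
by apply: (idealD iQ2); apply: (ideal_mull iQ2).
Qed.

End CotangentBasis.

(** * The localization map and the embedding dimension *)

Section LocalizationMap.
Variables (A : comNzRingType) (Q : A -> Prop) (hQ : is_prime_ideal Q).
Let iQ := prime_ideal hQ.

Definition to_loc (a : A) : loc hQ := \pi_(loc hQ) (mkl a (nP1 hQ)).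

Lemma to_loc_eq a b : to_loc a = to_loc b <-> exists2 u, ~ Q u & u * (a - b) = 0.
Proof.
split.
  move=> /eqP/eqlP [u nu]; rewrite /mkl /lnum /lden /= => hu.
  by exists u => //; rewrite -[RHS]hu; ring.
move=> [u nu hu]; apply/eqP/eqlP; exists u => //.
by rewrite /mkl /lnum /lden /= -[RHS]hu; ring.
Qed.

Lemma loc_piE (x y : lpair Q) u : ~ Q u ->
  u * (lnum x * lden y - lnum y * lden x) = 0 -> \pi_(loc hQ) x = \pi_(loc hQ) y.
Proof. by move=> nu hu; apply/eqP/eqlP; exists u. Qed.

Lemma to_loc_zmod : zmod_morphism to_loc.
Proof.
move=> a b; apply/eqP; rewrite eq_sym subr_eq /to_loc -loc_piD; apply/eqP.
by apply: (loc_piE (prime1 hQ)); rewrite /ladd /mkl /lnum /lden /=; ring.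
Qed.

Lemma to_loc_monoid : monoid_morphism to_loc.
Proof.
split=> [|a b]; first by rewrite -(loc_pi1 hQ).
rewrite /to_loc -loc_piM.
by apply: (loc_piE (prime1 hQ)); rewrite /lmul /mkl /lnum /lden /=; ring.
Qed.

HB.instance Definition _ := GRing.isZmodMorphism.Build A (loc hQ) to_loc to_loc_zmod.
HB.instance Definition _ := GRing.isMonoidMorphism.Build A (loc hQ) to_loc to_loc_monoid.

Lemma to_loc_den (x : lpair Q) : to_loc (lden x) * \pi_(loc hQ) x = to_loc (lnum x).
Proof.
rewrite /to_loc -loc_piM; apply: (loc_piE (prime1 hQ)).
by rewrite /lmul /mkl /lnum /lden /=; ring.
Qed.

Lemma to_loc_frac (z : loc hQ) : exists s a, ~ Q s /\ to_loc s * z = to_loc a.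
Proof.
exists (lden (repr z)), (lnum (repr z)); split; first exact: ldenP.
by rewrite -{2}(reprK z) to_loc_den.
Qed.

Lemma to_loc_unit s : ~ Q s -> exists t, t * to_loc s = 1.
Proof.
move=> ns; exists (\pi_(loc hQ) (mkl 1 ns)).
rewrite mulrC -[X in to_loc X](_ : lden (mkl 1 ns) = s) // to_loc_den.
by rewrite -to_loc_monoid.1.
Qed.

Let im : is_ideal (locmax hQ) := (locmax_proper hQ).1.

Lemma locmaxP a : locmax hQ (to_loc a) <-> Q a.
Proof.
split; last by move=> Qa; exists (mkl a (nP1 hQ)).
move=> [x [Qx e]]; have : to_loc (lden x * a) = to_loc (lnum x).
  by rewrite rmorphM /= e to_loc_den.
move/to_loc_eq => [u nu hu]; apply: contrapT => na.
apply: (nprimeM hQ nu (nprimeM hQ (@ldenP _ _ x) na)).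
have -> : u * (lden x * a) = u * (lden x * a - lnum x) + u * lnum x by ring.
by rewrite hu add0r; apply: ideal_mull.
Qed.

Lemma locmax_unitl s z : ~ Q s -> locmax hQ (to_loc s * z) -> locmax hQ z.
Proof.
move=> /to_loc_unit [t ht] /(ideal_mull im t); by rewrite mulrA ht mul1r.
Qed.

Lemma ideal_sq_to_loc a :
  ideal_sq (locmax hQ) (to_loc a) <-> exists2 u, ~ Q u & ideal_sq Q (u * a).
Proof.
have iQ2 := ideal_sq_ideal iQ.
split; last first.
  move=> [u /to_loc_unit [t ht] hu].
  suff : ideal_sq (locmax hQ) (to_loc (u * a)).
    move/(ideal_mull (ideal_sq_ideal im) t).
    by rewrite rmorphM /= mulrA ht mul1r.
  move: hu; case=> k [y [z [h ->]]].
  exists k, (to_loc \o y), (to_loc \o z); split.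
    by move=> i; split; apply/locmaxP; case: (h i).
  by rewrite rmorph_sum; apply: eq_bigr => i _; rewrite rmorphM /=.
pose J z := exists s a, [/\ ~ Q s, to_loc s * z = to_loc a & ideal_sq Q a].
suff h : ideal_sq (locmax hQ) (to_loc a) -> J (to_loc a).
  move=> /h [s [b [ns]]]; rewrite -rmorphM => /to_loc_eq [u nu hu] hb.
  exists (u * s); first exact: nprimeM.
  have -> : u * s * a = u * (s * a - b) + u * b by ring.
  by rewrite hu add0r; apply: ideal_mull.
apply: ideal_sq_min; first split.
- exists 1, 0; split; [exact: prime1| by rewrite mulr0 rmorph0 | exact: ideal0].
- move=> x y [s [b [ns e hb]]] [s' [b' [ns' e' hb']]].
  exists (s * s'), (s' * b + s * b'); split; first exact: nprimeM.
    rewrite rmorphD !rmorphM /= -e -e'; ring.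
  by apply: (idealD iQ2); apply: (ideal_mull iQ2).
- move=> x y [s [b [ns e hb]]]; have [s' [c [ns' e']]] := to_loc_frac x.
  exists (s * s'), (c * b); split; first exact: nprimeM.
    rewrite !rmorphM /= -e -e'; ring.
  exact: (ideal_mull iQ2).
- move=> x y mx my; have [s [b [ns e]]] := to_loc_frac x.
  have [s' [b' [ns' e']]] := to_loc_frac y.
  exists (s * s'), (b * b'); split; first exact: nprimeM.
    rewrite !rmorphM /= -e -e'; ring.
  by apply: ideal_sq_prod; apply/locmaxP; rewrite -?e -?e'; apply: (ideal_mull im).
Qed.

Lemma edim_cot_basis d (x : 'I_d -> A) : cot_basis Q x -> edim_at Q d.
Proof.
move=> [Qx fx sx]; exists hQ; split.
  exists (to_loc \o x); split; first by move=> i; apply/locmaxP.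
  move=> c; have /choice [sa hsa] : forall i, exists sa : A * A, ~ Q sa.1 /\
      to_loc sa.1 * c i = to_loc sa.2.
    by move=> i; have [s [a h]] := to_loc_frac (c i); exists (s, a).
  move=> hc i.
  (* Cofactors of the common denominator [s] below: [s] times [c j] is the image of
     [rest j * (sa j).2]. *)
  pose rest i := \prod_(j | j != i) (sa j).1.
  have nrest j : ~ Q (rest j).
    apply: (big_ind (fun s => ~ Q s)) => [|u v|k _]; [exact: prime1|exact: nprimeM|].
    exact: (hsa k).1.
  pose s := \prod_j (sa j).1.
  have sE j : s = rest j * (sa j).1 by rewrite /s (bigD1 j) //= mulrC.
  have : ideal_sq (locmax hQ) (to_loc (\sum_j rest j * (sa j).2 * x j)).
    have -> : to_loc (\sum_j rest j * (sa j).2 * x j) =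
       to_loc s * \sum_j c j * (to_loc \o x) j.
      rewrite rmorph_sum mulr_sumr; apply: eq_bigr => j _ /=.
      by rewrite (sE j) !rmorphM /= -(hsa j).2; ring.
    exact: (ideal_mull (ideal_sq_ideal im)).
  move/ideal_sq_to_loc => [u nu /(fx _ _ nu) /(_ i) /(primeMl hQ (nrest i))].
  by move/locmaxP; rewrite -(hsa i).2; apply: locmax_unitl; exact: (hsa i).1.
(* Upper bound: the numerators of [d + 1] independent elements of [locmax hQ] would be [d + 1]
   independent elements of [Q], against the spanning family [x] of size [d]. *)
move=> y [my fy].
have /choice [sa hsa] : forall i, exists sa : A * A, ~ Q sa.1 /\
    to_loc sa.1 * y i = to_loc sa.2.
  by move=> i; have [s [a h]] := to_loc_frac (y i); exists (s, a).
have Qa i : Q (sa i).2.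
  by apply/locmaxP; rewrite -(hsa i).2; apply: (ideal_mull im).
suff /(cot_free_le hQ Qa Qx)/(_ sx) : cot_free Q (fun i => (sa i).2) by rewrite ltnn.
move=> u c nu hu i.
have := fy (fun i => to_loc (c i * (sa i).1)).
have -> : \sum_i to_loc (c i * (sa i).1) * y i = to_loc (\sum_i c i * (sa i).2).
  rewrite rmorph_sum; apply: eq_bigr => j _.
  by rewrite !rmorphM /= -mulrA (hsa j).2.
move=> h; have /h/(_ i)/locmaxP : ideal_sq (locmax hQ) (to_loc (\sum_i c i * (sa i).2)).
  by apply/ideal_sq_to_loc; exists u.
by apply: primeMr => //; exact: (hsa i).1.
Qed.

End LocalizationMap.

(** * The extended ideal [I[X]] in one variable *)

Definition all_coef (A : comNzRingType) (I : A -> Prop) (g : {poly A}) := forall i, I g`_i.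

Section CoefficientIdeal.
Variables (A : comNzRingType) (I : A -> Prop).
Hypothesis hI : is_ideal I.

Lemma all_coef_ideal : is_ideal (all_coef I).
Proof.
split.
- by move=> i; rewrite coef0; apply: ideal0.
- by move=> f g hf hg i; rewrite coefD; apply: idealD.
- by move=> a g hg i; rewrite coefM; apply: (ideal_sum hI) => j _; apply: ideal_mull.
Qed.

Lemma all_coefC c : all_coef I c%:P <-> I c.
Proof.
split=> [/(_ 0%N)|Ic i]; rewrite coefC ?eqxx //.
by case: eqP => // _; apply: ideal0.
Qed.

Lemma all_coefMXaddC g c : all_coef I (g * 'X + c%:P) <-> all_coef I g /\ I c.
Proof.
split=> [h|[hg hc] i].
  split=> [i|]; last by have := h 0%N; rewrite coefD coefMX coefC /= add0r.
  by have := h i.+1; rewrite coefD coefMX coefC /= addr0.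
rewrite coefD coefMX coefC; case: i => [|i] /=; first by rewrite add0r.
by rewrite addr0.
Qed.

(** As in Gauss's lemma: if the first coefficients of [f] and [g] outside [I] have indices [i] and
    [j], then the coefficient of [f * g] at [i + j] is their product modulo [I]. *)
Lemma all_coef_prime : is_prime_ideal I -> is_prime_ideal (all_coef I).
Proof.
move=> pI; split; [exact: all_coef_ideal | by move/all_coefC; apply: prime1 |].
move=> f g hfg; apply: contrapT => /not_orP [nf ng].
have first_bad (h : {poly A}) : ~ all_coef I h ->
    exists2 i, ~ I h`_i & forall j, (j < i)%N -> I h`_j.
  move=> nh; have ex : exists i, `[< ~ I h`_i >].
    apply: contrapT => hn; apply: nh => i; apply: contrapT => ni.
    by apply: hn; exists i; apply/asboolP.
  case: (ex_minnP ex) => i /asboolP ni hmin; exists i => // j ltji.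
  apply: contrapT => nj; have := hmin j; rewrite leqNgt ltji => /(_ _)/negP; apply.
    exact/asboolP.
  by [].
have [i ni hi] := first_bad _ nf; have [j nj hj] := first_bad _ ng.
apply: (nprimeM pI ni nj).
have := hfg (i + j)%N; rewrite coefM.
have lti : (i < (i + j).+1)%N by rewrite ltnS leq_addr.
rewrite (bigD1 (Ordinal lti)) //= addKn; apply: contraPP => nij hs; apply: nij.
apply: (idealBr hI (y := - \sum_(k < (i + j).+1 | k != Ordinal lti) f`_k * g`_(i + j - k))).
  by rewrite opprK.
apply: (idealN hI); apply: (ideal_sum hI) => k /eqP nk.
have [ltki|leik] := ltnP k i; first by apply: (ideal_mulr hI); apply: hi.
apply: (ideal_mull hI); apply: hj.
have : (k : nat) != i by apply/eqP => e; apply: nk; apply: val_inj.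
by have : (k < (i + j).+1)%N := ltn_ord k; lia.
Qed.

End CoefficientIdeal.

(** * Cotangent bases for a prime of [A[X]] *)

Section OneVariable.
Variables (A : comNzRingType) (P : {poly A} -> Prop).
Hypothesis hP : is_prime_ideal P.
Let q (a : A) := P a%:P.
Hypothesis hq : is_prime_ideal q.
Variables (e : nat) (x : 'I_e -> A).
Hypothesis hx : cot_basis q x.
Let iP := prime_ideal hP.
Let iq := prime_ideal hq.
Let iP2 := ideal_sq_ideal iP.
Let iq2 := ideal_sq_ideal iq.
Let iqX := all_coef_ideal iq.
Let iq2X := all_coef_ideal iq2.
Let pqX := all_coef_prime iq hq.

Lemma all_coef_sub g : all_coef q g -> P g.
Proof.
elim/poly_ind: g => [|g c IH]; first by move=> _; apply: ideal0.
move/all_coefMXaddC => [/IH hg hc].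
by apply: (idealD iP) => //; apply: ideal_mulr.
Qed.

Lemma all_coef_sq_sub g : all_coef (ideal_sq q) g -> ideal_sq P g.
Proof.
elim/poly_ind: g => [|g c IH]; first by move=> _; apply: (ideal0 iP2).
move/all_coefMXaddC => [/IH hg hc].
apply: (idealD iP2); first exact: (ideal_mulr iP2).
case: hc => [k [y [z [h ->]]]]; exists k, (fun i => (y i)%:P), (fun i => (z i)%:P).
by split=> //; rewrite rmorph_sum; apply: eq_bigr => i _; rewrite rmorphM.
Qed.

Lemma all_coef_prod f g : all_coef q f -> all_coef q g -> all_coef (ideal_sq q) (f * g).
Proof.
move=> hf hg i; rewrite coefM; apply: (ideal_sum iq2) => j _.
exact: ideal_sq_prod.
Qed.

(** Each coefficient of [g] is expressed through [x] with its own denominator; the induction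
    multiplies these into one constant [s]. *)
Lemma all_coef_spans g : all_coef q g -> exists s c, ~ q s /\
  all_coef (ideal_sq q) (s%:P * g - \sum_i c i * (x i)%:P).
Proof.
elim/poly_ind: g => [_|g a IH].
  exists 1, (fun=> 0); split; first exact: prime1.
  rewrite mulr0 big1 ?subr0; [exact: (ideal0 iq2X) | by move=> i _; rewrite mul0r].
move/all_coefMXaddC => [/IH [s [c [ns hs]]] qa].
case: hx => _ _ sx; have [u [b [nu hu]]] := sx _ qa.
exists (u * s), (fun i => u%:P * c i * 'X + (s * b i)%:P).
split; first exact: nprimeM.
have -> : (u * s)%:P * (g * 'X + a%:P)
    - \sum_i (u%:P * c i * 'X + (s * b i)%:P) * (x i)%:P
  = u%:P * (s%:P * g - \sum_i c i * (x i)%:P) * 'X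
    + (s * (u * a - \sum_i b i * x i))%:P.
  have -> : \sum_i (u%:P * c i * 'X + (s * b i)%:P) * (x i)%:P
    = u%:P * (\sum_i c i * (x i)%:P) * 'X + (s * \sum_i b i * x i)%:P.
    rewrite !mulr_sumr mulr_suml rmorph_sum -big_split /=; apply: eq_bigr => i _.
    by rewrite !rmorphM /=; ring.
  by rewrite !rmorphM rmorphB !rmorphM /=; ring.
apply/all_coefMXaddC; split; first exact: (ideal_mull iq2X).
exact: (ideal_mull iq2).
Qed.

Lemma all_coef_free (c : 'I_e -> {poly A}) :
  all_coef (ideal_sq q) (\sum_i c i * (x i)%:P) -> forall i, all_coef q (c i).
Proof.
move=> h i j; case: hx => _ fx _; apply: (fx 1 (fun i => (c i)`_j) (prime1 hq)).
rewrite mul1r; have := h j; rewrite coef_sum.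
by under eq_bigr => k _ do rewrite coefMC.
Qed.

(** Here [P = q[X]], so the square of [P] has its coefficients in the square of [q], and both
    properties are checked coefficientwise. *)
Lemma cot_basis_extended : (forall g, P g -> all_coef q g) ->
  cot_basis P (fun i => (x i)%:P).
Proof.
move=> hPq; case: (hx) => Qx _ _; split; first exact: Qx.
- move=> u c nu hu i; apply: (primeMl hP nu); apply: all_coef_sub.
  apply: (all_coef_free (c := fun i => u * c i)).
  under eq_bigr => j _ do rewrite -mulrA.
  rewrite -mulr_sumr; move: hu; apply: (ideal_sq_min iq2X).
  by move=> f g /hPq hf /hPq hg; apply: all_coef_prod.
- move=> g /hPq /all_coef_spans [s [c [ns h]]]; exists s%:P, c; split=> //.
  exact: all_coef_sq_sub.
Qed.

Section Generator.
Variable f : {poly A}.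
Hypotheses (Pf : P f) (nf : ~ q (lead_coef f)).
Hypothesis f_min : forall g, P g -> (size g < size f)%N -> all_coef q g.

Lemma generator_nz : f != 0.
Proof. by apply/eqP => f0; apply: nf; rewrite f0 lead_coef0; apply: (ideal0 iq). Qed.

Lemma generator_nq : ~ all_coef q f.
Proof. by move=> h; apply: nf; apply: h. Qed.

(** Pseudo-division by [f] costs only a power of its leading coefficient, which lies outside [q];
    the remainder is in [P] and shorter than [f], hence in [q[X]]. So [P] is generated by [f] and
    [q[X]] up to denominators. *)
Lemma generator_div g : P g -> exists s h r,
  [/\ ~ q s, s%:P * g = h * f + r & all_coef q r].
Proof.
move=> Pg; exists (lead_coef f ^+ Pdiv.Ring.rscalp g f), (Pdiv.Ring.rdivp g f), (Pdiv.Ring.rmodp g f).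
have E := Pdiv.ComRing.rdivp_eq f g; split.
- exact: nprimeX.
- by rewrite mul_polyC.
- apply: f_min; last by rewrite Pdiv.Ring.ltn_rmodp generator_nz.
  rewrite -[Pdiv.Ring.rmodp _ _](addKr (Pdiv.Ring.rdivp g f * f)) -E addrC.
  rewrite -mul_polyC; apply: (idealB iP); [exact: (ideal_mull iP)|exact: (ideal_mull iP)].
Qed.

(** This is the square of [(f) + q[X]], up to denominators outside [q]. *)
Lemma generator_div_sq g : ideal_sq P g -> exists s a b c,
  [/\ ~ q s, s%:P * g = a + b * f + c * f ^+ 2,
      all_coef (ideal_sq q) a & all_coef q b].
Proof.
pose J g := exists s a b c, [/\ ~ q s, s%:P * g = a + b * f + c * f ^+ 2,
  all_coef (ideal_sq q) a & all_coef q b].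
suff [iJ hJ] : is_ideal J /\ forall g g', P g -> P g' -> J (g * g').
  exact: (ideal_sq_min iJ hJ).
clear g; split; first split.
- exists 1, 0, 0, 0; split; [exact: prime1| by ring | exact: (ideal0 iq2X)|exact: (ideal0 iqX)].
- move=> g g' [s [a [b [c [ns E ha hb]]]]] [s' [a' [b' [c' [ns' E' ha' hb']]]]].
  exists (s * s'), (s'%:P * a + s%:P * a'), (s'%:P * b + s%:P * b'),
    (s'%:P * c + s%:P * c'); split; first exact: nprimeM.
  + rewrite rmorphM /=.
    have -> : s%:P * s'%:P * (g + g') = s'%:P * (s%:P * g) + s%:P * (s'%:P * g') by ring.
    by rewrite E E'; ring.
  + by apply: (idealD iq2X); apply: (ideal_mull iq2X).
  + by apply: (idealD iqX); apply: (ideal_mull iqX).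
- move=> d g [s [a [b [c [ns E ha hb]]]]].
  exists s, (d * a), (d * b), (d * c); split=> //.
  + by rewrite mulrCA E; ring.
  + exact: (ideal_mull iq2X).
  + exact: (ideal_mull iqX).
- move=> g g' /generator_div [s [h [r [ns E hr]]]] /generator_div [s' [h' [r' [ns' E' hr']]]].
  exists (s * s'), (r * r'), (h * r' + h' * r), (h * h'); split.
  + exact: nprimeM.
  + rewrite rmorphM /=.
    have -> : s%:P * s'%:P * (g * g') = (s%:P * g) * (s'%:P * g') by ring.
    by rewrite E E'; ring.
  + exact: all_coef_prod.
  + by apply: (idealD iqX); apply: (ideal_mull iqX).
Qed.

Definition add_generator (i : 'I_e.+1) : {poly A} :=
  if unlift ord0 i is Some j then (x j)%:P else f.

Lemma sum_add_generator (c : 'I_e.+1 -> {poly A}) :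
  \sum_i c i * add_generator i =
  c ord0 * f + \sum_j c (lift ord0 j) * (x j)%:P.
Proof.
rewrite big_ord_recl /add_generator unlift_none; congr (_ + _).
by apply: eq_bigr => j _; rewrite liftK.
Qed.

(** Spanning is division by [f]. For freeness, a relation is first read modulo the prime [q[X]],
    which does not contain [f], to control the coefficient of [f]; what remains is a relation among
    the [x j], read modulo [q^2[X]]. *)
Lemma cot_basis_add_generator : cot_basis P add_generator.
Proof.
case: (hx) => Qx _ _.
have qXx (c : 'I_e -> {poly A}) : all_coef q (\sum_j c j * (x j)%:P).
  by apply: (ideal_sum iqX) => j _; apply: (ideal_mull iqX); apply/(all_coefC iq)/Qx.
have nPs s : ~ q s -> ~ P s%:P by [].
split.
- by move=> i; rewrite /add_generator; case: unlift => // j; apply: Qx.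
- move=> u c nu; rewrite sum_add_generator.
  set c0 := c ord0; set sx := \sum_j _ => hu.
  have [s [a [b [g [ns E ha hb]]]]] := generator_div_sq hu.
  have ha' : all_coef q a by move=> i; apply: (ideal_sq_sub iq); apply: ha.
  (* Modulo [q[X]] the relation becomes [f * (s * u * c0 - g * f) = 0], and [f] can be cancelled. *)
  have Pc0 : P c0.
    have : P (s%:P * u * c0 - g * f).
      apply: all_coef_sub; apply: (primeMl pqX generator_nq).
      have -> : f * (s%:P * u * c0 - g * f) = a + b * f - s%:P * u * sx.
        have -> : a + b * f = s%:P * (u * (c0 * f + sx)) - g * f ^+ 2 by rewrite E; ring.
        by ring.
      apply: (idealB iqX); last by apply: (ideal_mull iqX); apply: qXx.
      by apply: (idealD iqX) => //; apply: (ideal_mulr iqX).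
    move=> h; have : P (s%:P * u * c0) by apply: (idealBr iP h); apply: (ideal_mull iP).
    by apply: (primeMl hP); apply: nprimeM => //; apply: nPs.
  (* Dividing [c0] by [f] moves the term [c0 * f] into the part linear and quadratic in [f], with
     new coefficients [b1] and [g1]. *)
  have [s1 [h [r [ns1 E1 hr]]]] := generator_div Pc0.
  pose b1 := s1%:P * b - s%:P * u * r; pose g1 := s1%:P * g - s%:P * u * h.
  have hb1 : all_coef q b1 by apply: (idealB iqX); apply: (ideal_mull iqX).
  have E2 : s1%:P * s%:P * u * sx = s1%:P * a + b1 * f + g1 * f ^+ 2.
    have -> : s1%:P * s%:P * u * sx
      = s1%:P * (s%:P * (u * (c0 * f + sx))) - s%:P * u * (s1%:P * c0) * f by ring.
    by rewrite E E1 /b1 /g1; ring.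
  have hg1 : all_coef q g1.
    apply: (primeMr pqX generator_nq); apply: (primeMr pqX generator_nq).
    have -> : g1 * f * f = s1%:P * s%:P * u * sx - s1%:P * a - b1 * f by rewrite E2; ring.
    apply: (idealB iqX); last exact: (ideal_mulr iqX).
    by apply: (idealB iqX); apply: (ideal_mull iqX) => //; apply: qXx.
  (* Since [b1 + g1 * f] lies in [q[X]], it is a combination of the [x i] modulo [q^2[X]]; its
     multiple by [f] can then be absorbed into the coefficients of the [x i]. *)
  have [s2 [d [ns2 hd]]] : exists s2 d, ~ q s2 /\
      all_coef (ideal_sq q) (s2%:P * (b1 + g1 * f) - \sum_i d i * (x i)%:P).
    by apply: all_coef_spans; apply: (idealD iqX) => //; apply: (ideal_mulr iqX).
  pose t := s2%:P * s1%:P * s%:P * u.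
  have nt : ~ P t by do !apply: nprimeM => //.
  have free : forall j, all_coef q (t * c (lift ord0 j) - d j * f).
    apply: (all_coef_free (c := fun j => t * c (lift ord0 j) - d j * f)).
    have -> : \sum_i (t * c (lift ord0 i) - d i * f) * (x i)%:P =
       s2%:P * s1%:P * a + f * (s2%:P * (b1 + g1 * f) - \sum_i d i * (x i)%:P).
      have -> : \sum_i (t * c (lift ord0 i) - d i * f) * (x i)%:P
          = t * sx - f * \sum_i d i * (x i)%:P.
        by rewrite /sx !mulr_sumr -sumrB; apply: eq_bigr => i _; ring.
      have -> : t * sx = s2%:P * (s1%:P * s%:P * u * sx) by rewrite /t; ring.
      by rewrite E2; ring.
    by apply: (idealD iq2X); apply: (ideal_mull iq2X).
  move=> i; case: (unliftP ord0 i) => [j ->|->] //.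
  apply: (primeMl hP nt); apply: (idealBr iP (y := d j * f)); last exact: (ideal_mull iP).
  exact: all_coef_sub.
- move=> y Py; have [s [h [r [ns E hr]]]] := generator_div Py.
  have [s1 [c [ns1 hc]]] := all_coef_spans hr.
  exists (s1%:P * s%:P), (fun i => if unlift ord0 i is Some j then c j else s1%:P * h).
  split; first by apply: nprimeM => //; apply: nPs.
  rewrite sum_add_generator unlift_none.
  under eq_bigr => j _ do rewrite liftK.
  have -> : s1%:P * s%:P * y = s1%:P * (s%:P * y) by ring.
  rewrite E; apply: all_coef_sq_sub.
  have -> // : forall S, s1%:P * (h * f + r) - (s1%:P * h * f + S) = s1%:P * r - S.
  by move=> S; ring.
Qed.

End Generator.

Lemma exists_generator : ~ (forall g, P g -> all_coef q g) ->
  exists f, [/\ P f, ~ q (lead_coef f) &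
    forall g, P g -> (size g < size f)%N -> all_coef q g].
Proof.
move=> hn; pose bad d := `[< exists g, [/\ P g, ~ all_coef q g & size g = d] >].
have : exists d, bad d.
  apply: contrapT => nb; apply: hn => g Pg; apply: contrapT => ng; apply: nb.
  by exists (size g); apply/asboolP; exists g.
case/ex_minnP => d /asboolP [f [Pf nf sf]] hmin; exists f.
have f_min g : P g -> (size g < size f)%N -> all_coef q g.
  move=> Pg; apply: contraPP => ng; apply/negP; rewrite -leqNgt sf; apply: hmin.
  by apply/asboolP; exists g.
split=> // qf; apply: (nf).
have f0 : f != 0.
  by apply/eqP => f0; apply: nf; rewrite f0; apply: (ideal0 iqX).
(* If the leading coefficient were in [q], removing the leading term would leave a shorter element
   of [P], in [q[X]] by minimality, and [f] itself would be in [q[X]]. *)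
have hqX : all_coef q (lead_coef f *: 'X^((size f).-1)).
  by rewrite -mul_polyC; apply: (ideal_mulr iqX); apply/(all_coefC iq).
apply: (idealBr iqX _ hqX); apply: f_min.
  by apply: (idealB iP) => //; apply: all_coef_sub.
have : (0 < size f)%N by rewrite size_poly_gt0.
move=> s0; rewrite -[X in (_ < X)%N](prednK s0) ltnS; apply/leq_sizeP => j hj.
rewrite coefB coefZ coefXn; move: hj; rewrite leq_eqVlt => /predU1P [<-|hj].
  by rewrite eqxx mulr1 lead_coefE subrr.
by rewrite gtn_eqF // mulr0 subr0 nth_default // -(prednK s0).
Qed.

Lemma cot_basis_poly : exists y : 'I_(e + `[< exists2 g, P g & ~ all_coef q g >]) -> {poly A},
  cot_basis P y.
Proof.
case: asboolP => h.
  have [f [Pf nf hmin]] : exists f, [/\ P f, ~ q (lead_coef f) &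
      forall g, P g -> (size g < size f)%N -> all_coef q g].
    by apply: exists_generator => hn; case: h => g /hn.
  by rewrite addn1; exists (add_generator f); apply: cot_basis_add_generator.
rewrite addn0; exists (fun i => (x i)%:P); apply: cot_basis_extended => g Pg.
by apply: contrapT => ng; apply: h; exists g.
Qed.

End OneVariable.

(** * Transport of primes and cotangent bases along ring morphisms *)

Lemma pred_ext (T : Type) (P Q : T -> Prop) : (forall x, P x <-> Q x) -> P = Q.
Proof. by move=> h; apply/funext => x; apply/propext. Qed.

Lemma preim_prime (A B : comNzRingType) (phi : {rmorphism A -> B}) (P : B -> Prop) :
  is_prime_ideal P -> is_prime_ideal (fun a => P (phi a)).
Proof.
move=> hP; have iP := prime_ideal hP; split; first split.
- by rewrite rmorph0; apply: ideal0.
- by move=> x y hx hy; rewrite rmorphD; apply: idealD.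
- by move=> a x hx; rewrite rmorphM; apply: ideal_mull.
- by rewrite rmorph1; apply: prime1.
- by move=> x y; rewrite rmorphM => /(primeM hP).
Qed.

Lemma ideal_sq_morph (A B : comNzRingType) (phi : {rmorphism A -> B})
  (I : A -> Prop) (J : B -> Prop) : (forall a, I a -> J (phi a)) ->
  forall a, ideal_sq I a -> ideal_sq J (phi a).
Proof.
move=> h _ [k [y [z [yz ->]]]]; exists k, (phi \o y), (phi \o z); split.
  by move=> i; case: (yz i) => hy hz; split; apply: h.
by rewrite rmorph_sum; apply: eq_bigr => i _; rewrite rmorphM.
Qed.

Lemma cot_basis_iso (A B : comNzRingType) (phi : {rmorphism A -> B})
  (psi : {rmorphism B -> A}) (P : B -> Prop) d (x : 'I_d -> A) :
  cancel phi psi -> cancel psi phi ->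
  cot_basis (fun a => P (phi a)) x -> cot_basis P (phi \o x).
Proof.
move=> phiK psiK [Qx fx sx].
have toP a : ideal_sq (fun a => P (phi a)) a -> ideal_sq P (phi a) by apply: ideal_sq_morph.
have ofP b : ideal_sq P b -> ideal_sq (fun a => P (phi a)) (psi b).
  by apply: ideal_sq_morph => y; rewrite psiK.
split=> //.
- move=> u c nu /ofP hc i; rewrite -[c i]psiK.
  apply: (fx (psi u) (psi \o c)); first by rewrite psiK.
  move: hc; rewrite rmorphM rmorph_sum /=; congr (ideal_sq _ (_ * _)).
  by apply: eq_bigr => j _; rewrite rmorphM /= phiK.
- move=> y Py; have [|u [c [nu /toP hc]]] := sx (psi y); first by rewrite psiK.
  exists (phi u), (phi \o c); split=> //.
  move: hc; rewrite rmorphB rmorphM rmorph_sum /= psiK; congr (ideal_sq _ (_ - _)).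
  by apply: eq_bigr => j _; rewrite rmorphM.
Qed.

(** * Splitting off the last variable, and the rank of a prime *)

Section MpolyMorphisms.
Variables (R : comNzRingType) (n : nat).

Lemma mpoly_rmorph_ext (S : comNzRingType) (f g : {rmorphism {mpoly R[n]} -> S}) :
  (forall c, f c%:MP = g c%:MP) -> (forall i, f 'X_i = g 'X_i) -> f =1 g.
Proof.
move=> hC hX p; rewrite [p]mpolyE !rmorph_sum; apply: eq_bigr => m _.
rewrite -mul_mpolyC !rmorphM hC; congr (_ * _).
rewrite mpolyXE_id !rmorph_prod; apply: eq_bigr => i _.
by rewrite !rmorphXn hX.
Qed.

Lemma mwiden_var (i : 'I_n) :
  mwiden 'X_i = 'X_(widen_ord (leqnSn n) i) :> {mpoly R[n.+1]}.
Proof. by rewrite /mwiden mmapX mmap1U. Qed.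

Lemma muni_var (i : 'I_n) :
  muni ('X_(widen_ord (leqnSn n) i) : {mpoly R[n.+1]}) = ('X_i)%:P.
Proof.
rewrite /muni mmapX mmap1U; case: splitP => [j /= eij|j /= ei].
  by congr ('X__)%:P; apply/val_inj.
by have := ltn_ord i; rewrite ei ltnNge leq_addr.
Qed.

Lemma muni_var_max : muni ('X_ord_max : {mpoly R[n.+1]}) = 'X.
Proof.
rewrite /muni mmapX mmap1U; case: splitP => // j /= ei.
by have := ltn_ord j; rewrite -ei ltnn.
Qed.

(** The inverse of [muni], written as a composite of ring morphisms so as to inherit their
    structure. *)
Definition unmuni (h : {poly {mpoly R[n]}}) : {mpoly R[n.+1]} :=
  (horner_eval 'X_ord_max \o map_poly (@mwiden n R)) h.
HB.instance Definition _ := GRing.RMorphism.copy unmuni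
  (horner_eval 'X_ord_max \o map_poly (@mwiden n R)).

Lemma unmuniC c : unmuni c%:P = mwiden c.
Proof. by rewrite /unmuni /= map_polyC /horner_eval hornerC. Qed.

Lemma unmuniX : unmuni 'X = 'X_ord_max.
Proof. by rewrite /unmuni /= map_polyX /horner_eval hornerX. Qed.

Lemma muniW (c : {mpoly R[n]}) : muni (mwiden c) = c%:P.
Proof.
apply: (mpoly_rmorph_ext (f := @muni n R \o @mwiden n R) (g := polyC)) => [a|i] /=.
  by rewrite mwidenC muniC.
by rewrite mwiden_var muni_var.
Qed.

Lemma unmuniK : cancel unmuni (@muni n R).
Proof.
elim/poly_ind => [|h c IH]; first by rewrite !rmorph0.
by rewrite rmorphD rmorphM /= unmuniC unmuniX rmorphD rmorphM /= IH muniW muni_var_max.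
Qed.

End MpolyMorphisms.

Lemma muniK (R : comNzRingType) n : cancel (@muni n R) (@unmuni R n).
Proof.
apply: (mpoly_rmorph_ext (f := @unmuni R n \o @muni n R) (g := idfun)) => [c|i] /=.
  by rewrite muniC unmuniC mwidenC.
case: (unliftP ord_max i) => [j ->|->]; last by rewrite muni_var_max unmuniX.
have -> : lift ord_max j = widen_ord (leqnSn n) j.
  by apply: val_inj; rewrite /= /bump leqNgt ltn_ord.
by rewrite muni_var unmuniC mwiden_var.
Qed.

(* [P R_p[X_1, ..., X_n]] needs [rk P] generators besides those of [p R_p]: the variable
   [X_k] contributes 1 when it is algebraic over [X_1, ..., X_(k-1)] modulo [P]. *)
Fixpoint rk (R : comNzRingType) n : ({mpoly R[n]} -> Prop) -> nat :=
  match n return ({mpoly R[n]} -> Prop) -> nat with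
  | 0 => fun=> 0%N
  | m.+1 => fun P => (rk (fun g : {mpoly R[m]} => P (mwiden g)) +
      `[< exists2 g, P g & ~ all_coef (fun c => P (mwiden c)) (muni g) >])%N
  end.

(** Induction on [n]: through [muni] and [unmuni] the last variable is adjoined by [cot_basis_poly],
    which enlarges the basis by exactly the last summand of [rk P]. *)
Lemma cot_basis_mpoly (R : comNzRingType) n (P : {mpoly R[n]} -> Prop) e (x : 'I_e -> R) :
  is_prime_ideal P -> cot_basis (contraction P) x ->
  exists y : 'I_(e + rk P) -> {mpoly R[n]}, cot_basis P y.
Proof.
elim: n P => [|n IH] P hP hx.
  rewrite addn0; exists (@mpolyC 0 R \o x).
  apply: (cot_basis_iso (psi := meval (fun=> 0 : R))) => //.
    by move=> c; apply: mevalC.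
  move=> p; apply: (mpoly_rmorph_ext (g := idfun)
    (f := @mpolyC 0 R \o meval (fun=> 0 : R))) => [c|[]] //=.
  by rewrite mevalC.
have [|y hy] := IH (fun g => P (mwiden g)) (preim_prime (@mwiden n R) hP).
  by rewrite (_ : contraction _ = contraction P) //; apply: pred_ext => c;
    rewrite /contraction mwidenC.
have hP' := @preim_prime {poly {mpoly R[n]}} {mpoly R[n.+1]} (@unmuni R n) P hP.
have qE : (fun a => P (unmuni a%:P)) = (fun c => P (mwiden c)).
  by apply: pred_ext => c; rewrite unmuniC.
have hq : is_prime_ideal (fun a => P (unmuni a%:P)).
  by rewrite qE; apply: (preim_prime (@mwiden n R)).
have [|z hz] := cot_basis_poly hP' hq (x := y); first by rewrite qE.
suff -> : (e + rk P = e + rk (fun g => P (mwiden g)) + `[< exists2 g,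
    P (unmuni g) & ~ all_coef (fun a => P (unmuni a%:P)) g >])%N.
  exists (@unmuni R n \o z).
  exact: (cot_basis_iso (@unmuniK R n) (@muniK R n) hz).
rewrite /= addnA qE; congr (_ + nat_of_bool _)%N; apply: asbool_equiv_eq; split.
  by move=> [g Pg hg]; exists (muni g); rewrite ?muniK.
by move=> [g Pg hg]; exists (unmuni g); rewrite ?unmuniK.
Qed.

(** * Invariance of the rank under base change *)

Section BaseChange.
Variables (R R' : comNzRingType) (phi : {rmorphism R -> R'}).

Lemma map_mpoly_var n (i : 'I_n) : map_mpoly phi 'X_i = 'X_i.
Proof. exact: map_mpolyX. Qed.

Lemma map_mpoly_mwiden n (g : {mpoly R[n]}) :
  map_mpoly phi (mwiden g) = mwiden (map_mpoly phi g).
Proof.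
apply: (mpoly_rmorph_ext (f := map_mpoly phi \o @mwiden n R)
  (g := @mwiden n R' \o map_mpoly phi)) => [c|i] /=.
  by rewrite mwidenC !map_mpolyC mwidenC.
by rewrite mwiden_var !map_mpoly_var mwiden_var.
Qed.

Lemma muni_map_mpoly n (g : {mpoly R[n.+1]}) :
  muni (map_mpoly phi g) = map_poly (map_mpoly phi) (muni g).
Proof.
rewrite -{1}[g]muniK; elim/poly_ind: (muni g) => [|h c IH]; first by rewrite !rmorph0.
rewrite !rmorphD !rmorphM /= unmuniC unmuniX map_mpoly_mwiden map_mpoly_var.
by rewrite muniW muni_var_max map_polyX map_polyC -IH.
Qed.

(** The finitely many coefficients have a common denominator. With [S] reduced to 1 this says that
    [map_mpoly phi] is surjective when [phi] is. *)
Lemma mpoly_denominator n (S : R -> Prop) (g' : {mpoly R'[n]}) :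
  (forall s t, S s -> S t -> S (s * t)) ->
  (forall r', exists s r, S s /\ phi s * r' = phi r) ->
  exists s g, S s /\ (phi s)%:MP * g' = map_mpoly phi g.
Proof.
move=> SM hS; elim/mpolyind: g' => [|c m p _ _ [s [g [Ss E]]]].
  by have [s [r [Ss _]]] := hS 0; exists s, 0; rewrite mulr0 rmorph0.
have [t [r [St Et]]] := hS c.
exists (s * t), (s%:MP * r%:MP * 'X_[m] + t%:MP * g); split; first exact: SM.
rewrite rmorphD !rmorphM /= !map_mpolyC /= map_mpolyX -E -Et -mul_mpolyC !mpolyCM.
by ring.
Qed.

(** Relations witnessing that a variable is algebraic map forward to [R']; they come back after
    clearing a denominator outside [P'], which does not affect membership of the coefficients in
    [P']. *)
Lemma rk_base_change n (P : {mpoly R[n]} -> Prop) (P' : {mpoly R'[n]} -> Prop) :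
  is_prime_ideal P' -> (forall g, P g <-> P' (map_mpoly phi g)) ->
  (forall r', exists s r, ~ P' (phi s)%:MP /\ phi s * r' = phi r) ->
  rk P = rk P'.
Proof.
elim: n P P' => [//|n IH] P P' hP' PP' hS /=; congr (_ + nat_of_bool _)%N.
  apply: IH; first exact: (preim_prime (@mwiden n R')).
    by move=> g; rewrite -map_mpoly_mwiden; apply: PP'.
  by move=> r'; have [s [r h]] := hS r'; exists s, r; rewrite mwidenC.
have coefE g i : P (mwiden (muni g)`_i) <-> P' (mwiden (muni (map_mpoly phi g))`_i).
  by rewrite muni_map_mpoly coef_map /= -map_mpoly_mwiden; apply: PP'.
apply: asbool_equiv_eq; split=> -[g Pg ng].
  exists (map_mpoly phi g); first exact/PP'.
  by move=> h; apply: ng => i; apply/coefE/h.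
have [|s [g0 [ns E]]] := mpoly_denominator g (S := fun s => ~ P' (phi s)%:MP) _ hS.
  by move=> s t ns nt; rewrite rmorphM /= mpolyCM; apply: nprimeM.
exists g0; first by apply/PP'; rewrite -E; apply: (ideal_mull (prime_ideal hP')).
move=> h; apply: ng => i; apply: (primeMl hP' ns).
have -> : (phi s)%:MP * mwiden (muni g)`_i = mwiden (muni (map_mpoly phi g0))`_i.
  by rewrite -E rmorphM /= muniC coefCM rmorphM /= mwidenC.
exact/coefE/h.
Qed.

End BaseChange.

(** * A chain of primes of length [rk P] *)

Section LastVariable.
Variables (R : comNzRingType) (n : nat) (P : {mpoly R[n.+1]} -> Prop).
Hypothesis hP : is_prime_ideal P.

Lemma all_coef_muni_sub g : all_coef (fun c => P (mwiden c)) (muni g) -> P g.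
Proof.
have hP' := @preim_prime {poly {mpoly R[n]}} {mpoly R[n.+1]} (@unmuni R n) P hP.
rewrite (_ : (fun c => P (mwiden c)) = (fun a => P (unmuni a%:P))).
  by move/(all_coef_sub hP') => /=; rewrite muniK.
by apply: pred_ext => c; rewrite unmuniC.
Qed.

End LastVariable.

(** The primes of a chain ending at the restriction of [P] to [n] variables are extended
    coefficientwise. The new top lies in [P], strictly exactly when the last variable counts in
    [rk P], and then [P] is appended. *)
Lemma chain_to_prime (R : comNzRingType) n (P : {mpoly R[n]} -> Prop) :
  is_prime_ideal P ->
  exists q, prime_chain q (rk P) /\ forall g, q (rk P) g <-> P g.
Proof.
elim: n P => [|n IH] P hP.
  by exists (fun=> P); split=> //; split=> [i _|i]; rewrite ?ltn0.
have hP' := preim_prime (@mwiden n R) hP.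
have [q [[qprime qincr] qP]] := IH _ hP'; clear hP'.
set h := rk _ in qprime qincr qP.
pose Q i (g : {mpoly R[n.+1]}) := all_coef (q i) (muni g).
have Qprime i : (i <= h)%N -> is_prime_ideal (Q i).
  move=> leih; have pq := qprime _ leih.
  exact: (@preim_prime {mpoly R[n.+1]} {poly {mpoly R[n]}} (@muni n R) _
    (all_coef_prime (prime_ideal pq) pq)).
have Qincr i : (i < h)%N -> (forall g, Q i g -> Q i.+1 g) /\ exists g, Q i.+1 g /\ ~ Q i g.
  move=> ltih; have [sub [x [Qx nx]]] := qincr _ ltih.
  split; first by move=> g hg j; apply: sub; apply: hg.
  exists (mwiden x); rewrite /Q muniW; split.
    by apply/all_coefC => //; apply: prime_ideal (qprime _ ltih).
  by move/(all_coefC (prime_ideal (qprime _ (ltnW ltih)))).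
have QP g : Q h g <-> all_coef (fun c => P (mwiden c)) (muni g).
  by split=> hg i; apply/qP; apply: hg.
rewrite /= -/h; case: asboolP => [[g0 Pg0 ng0]|nex].
  rewrite addn1; exists (fun i => if (i <= h)%N then Q i else P); split; last first.
    by move=> g; rewrite ltnn.
  split=> [i _|i]; first by case: ifP => [/Qprime|_].
  rewrite ltnS => leih; rewrite leih; case: ltnP => [/Qincr //|lehi].
  have -> : i = h by apply/eqP; rewrite eqn_leq leih.
  split; first by move=> g /QP /(all_coef_muni_sub hP).
  by exists g0; split=> // /QP.
rewrite addn0; exists Q; split=> // g; split; first by move/QP/(all_coef_muni_sub hP).
by move=> Pg; apply/QP; apply: contrapT => ng; apply: nex; exists g.
Qed.

(** * The extended ideal in several variables *)

Section CoefficientwiseIdeal.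
Variables (R : comNzRingType) (q : R -> Prop).
Hypothesis hq : is_ideal q.

Definition all_mcoeff n (g : {mpoly R[n]}) := forall m, q g@_m.

Lemma all_mcoeff_ideal n : is_ideal (@all_mcoeff n).
Proof.
split.
- by move=> m; rewrite mcoeff0; apply: ideal0.
- by move=> f g hf hg m; rewrite mcoeffD; apply: idealD.
- by move=> a g hg m; rewrite mcoeffM; apply: (ideal_sum hq) => k _; apply: ideal_mull.
Qed.

Lemma all_mcoeffC n c : q c -> all_mcoeff (c%:MP_[n]).
Proof. by move=> qc m; rewrite mcoeffC; apply: ideal_mulr. Qed.

(** The extended ideal is generated by the constants in [q]. *)
Lemma all_mcoeff_min n (S : comNzRingType) (J : S -> Prop) (phi : {rmorphism {mpoly R[n]} -> S}) g :
  is_ideal J -> (forall c, q c -> J (phi c%:MP)) -> all_mcoeff g -> J (phi g).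
Proof.
move=> iJ hJ hg; rewrite [g]mpolyE rmorph_sum; apply: (ideal_sum iJ) => m _.
by rewrite -mul_mpolyC rmorphM; apply: (ideal_mulr iJ); apply: hJ.
Qed.

Lemma all_mcoeff_muni n (g : {mpoly R[n.+1]}) :
  all_mcoeff g <-> all_coef (@all_mcoeff n) (muni g).
Proof.
have iX := all_mcoeff_ideal n.+1; split=> hg.
  apply: (@all_mcoeff_min _ {poly {mpoly R[n]}} _ (@muni n R)) hg.
    exact: (all_coef_ideal (all_mcoeff_ideal n)).
  by move=> c qc; rewrite /= muniC; apply/(all_coefC (all_mcoeff_ideal n)); apply: all_mcoeffC.
rewrite -[g]muniK; elim/poly_ind: (muni g) hg => [|h c IH].
  by move=> _; rewrite rmorph0; apply: (ideal0 iX).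
move/all_coefMXaddC => [/IH hh hc].
rewrite rmorphD rmorphM /= unmuniC; apply: (idealD iX); first exact: (ideal_mulr iX).
apply: (all_mcoeff_min (phi := @mwiden n R)) hc; first exact: iX.
by move=> a qa; rewrite /= mwidenC; apply: all_mcoeffC.
Qed.

End CoefficientwiseIdeal.

(** * The rank of a sequence of ring elements *)

Section Sequences.
Variables (R B : comNzRingType) (f : {rmorphism R -> B}).
Implicit Type W : nat -> B.

(* Sequences are indexed by [nat] so that all truncations share one [W]. *)
Definition evalm W N : {mpoly R[N]} -> B := mmap f (fun i : 'I_N => W i).
HB.instance Definition _ W N := GRing.RMorphism.copy (@evalm W N) (mmap f (fun i : 'I_N => W i)).

Lemma evalmC W N c : evalm W c%:MP_[N] = f c.
Proof. exact: mmapC. Qed.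

Lemma evalm_var W N (i : 'I_N) : evalm W 'X_i = W i.
Proof. by rewrite /evalm mmapX mmap1U. Qed.

Lemma eq_evalm W W' N : (forall i, (i < N)%N -> W i = W' i) ->
  @evalm W N =1 @evalm W' N.
Proof.
move=> h; apply: mpoly_rmorph_ext => [c|i] /=; first by rewrite !evalmC.
by rewrite !evalm_var h.
Qed.

Lemma evalm_mwiden W N (g : {mpoly R[N]}) : evalm W (mwiden g) = evalm W g.
Proof.
apply: (mpoly_rmorph_ext (f := @evalm W N.+1 \o @mwiden N R) (g := @evalm W N)) => [c|i] /=.
  by rewrite mwidenC !evalmC.
by rewrite mwiden_var !evalm_var.
Qed.

Lemma evalm_muni W N (g : {mpoly R[N.+1]}) :
  evalm W g = (map_poly (@evalm W N) (muni g)).[W N].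
Proof.
rewrite -{1}[g]muniK; elim/poly_ind: (muni g) => [|h c IH].
  by rewrite !rmorph0 horner0.
rewrite rmorphD rmorphM /= unmuniC unmuniX rmorphD rmorphM /= evalm_mwiden evalm_var IH.
by rewrite rmorphD rmorphM /= map_polyX map_polyC hornerMXaddC.
Qed.

Variable Q : B -> Prop.
Hypothesis hQ : is_prime_ideal Q.

Definition evalm_preim W N (g : {mpoly R[N]}) := Q (evalm W g).
(** Counts the terms among [W 0, ..., W (N - 1)] that are algebraic over the preceding ones modulo
    [Q]. *)
Definition rkseq W N := rk (@evalm_preim W N).

Lemma evalm_preim_prime W N : is_prime_ideal (@evalm_preim W N).
Proof. exact: (preim_prime (@evalm W N) hQ). Qed.

Lemma eq_rkseq W W' N : (forall i, (i < N)%N -> W i = W' i) -> rkseq W N = rkseq W' N.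
Proof.
move=> h; congr rk; apply: pred_ext => g.
by rewrite /evalm_preim (eq_evalm h).
Qed.

Lemma rkseqS W N : rkseq W N.+1 = (rkseq W N +
   `[< exists2 g, evalm_preim W g & ~ all_coef (@evalm_preim W N) (muni g) >])%N.
Proof.
rewrite /rkseq /=.
have -> // : (fun g => evalm_preim W (mwiden g)) = @evalm_preim W N.
by apply: pred_ext => g; rewrite /evalm_preim evalm_mwiden.
Qed.

Lemma rkseq_addl W N j : (rkseq W (j + N) <= j + rkseq W N)%N.
Proof.
elim: j => [//|j IH]; rewrite addSn rkseqS.
by case: asbool; rewrite ?addn1 ?addn0 ?ltnS // addSn leqW.
Qed.

Lemma rkseq_algebraic W N h : W N = evalm W (h : {mpoly R[N]}) ->
  rkseq W N.+1 = (rkseq W N).+1.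
Proof.
move=> e; rewrite rkseqS; case: asboolP => [_|[]]; first by rewrite addn1.
(* This relation is monic in the last variable, so its coefficient 1 is outside the prime. *)
exists ('X_ord_max - mwiden h).
  rewrite /evalm_preim rmorphB /= evalm_var evalm_mwiden e subrr.
  exact: ideal0 (prime_ideal hQ).
move=> /(_ 1%N); rewrite rmorphB /= muniW muni_var_max coefB coefX coefC subr0 /=.
exact: prime1 (evalm_preim_prime W N).
Qed.

(** Once the first [N] terms generate [B], every later term is a polynomial in them, hence
    counted. *)
Lemma rkseq_generated W N j : (forall b, exists h : {mpoly R[N]}, evalm W h = b) ->
  rkseq W (j + N) = (j + rkseq W N)%N.
Proof.
move=> gen.
have {}gen i b : exists h : {mpoly R[i + N]}, evalm W h = b.
  elim: i => [|i [h <-]]; first exact: gen.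
  by exists (mwiden h); rewrite evalm_mwiden.
elim: j => [//|j IH]; rewrite addSn; have [h eh] := gen j (W (j + N)%N).
by rewrite (rkseq_algebraic (esym eh)) IH.
Qed.

(** Permuting the variables is an automorphism of [{mpoly R[N]}] carrying one preimage of [Q] to the
    other. These primes have cotangent bases of sizes [e + rkseq W N] and [e + rkseq W' N], which
    must agree. *)
Lemma rkseq_perm W W' N (s t : 'I_N -> 'I_N) e (x : 'I_e -> R) :
  cot_basis (fun r => Q (f r)) x ->
  cancel s t -> cancel t s -> (forall i : 'I_N, W i = W' (s i)) ->
  rkseq W N = rkseq W' N.
Proof.
move=> hx sK tK WW'.
pose phi u : {rmorphism {mpoly R[N]} -> {mpoly R[N]}} :=
  mmap (@mpolyC N R) (fun i => 'X_(u i)).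
have phiX u i : phi u 'X_i = 'X_(u i) by rewrite /= mmapX mmap1U.
have phiC u c : phi u c%:MP = c%:MP by rewrite /= mmapC.
have phiK u v : cancel u v -> cancel (phi u) (phi v).
  move=> uK; apply: (mpoly_rmorph_ext (f := phi v \o phi u) (g := idfun)) => [c|i].
    by change (phi v (phi u c%:MP) = c%:MP); rewrite !phiC.
  by change (phi v (phi u 'X_i) = 'X_i); rewrite !phiX uK.
have evE g : evalm W g = evalm W' (phi s g).
  apply: (mpoly_rmorph_ext (f := @evalm W N) (g := @evalm W' N \o phi s)) => [c|i].
    by change (@evalm W N c%:MP = @evalm W' N (phi s c%:MP)); rewrite phiC !evalmC.
  by change (@evalm W N 'X_i = @evalm W' N (phi s 'X_i));
    rewrite phiX !evalm_var.
have basisC V : cot_basis (contraction (@evalm_preim V N)) x.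
  rewrite (_ : contraction _ = fun r => Q (f r)) //.
  by apply: pred_ext => c; rewrite /contraction /evalm_preim evalmC.
have [y hy] := cot_basis_mpoly (evalm_preim_prime W N) (basisC W).
have [y' hy'] := cot_basis_mpoly (evalm_preim_prime W' N) (basisC W').
have pE : @evalm_preim W N = fun g => evalm_preim W' (phi s g).
  by apply: pred_ext => g; rewrite /evalm_preim evE.
have hz : cot_basis (fun g => evalm_preim W' (phi s g)) y by rewrite -pE.
have := cot_basis_iso (phiK _ _ sK) (phiK _ _ tK) hz.
move=> /(cot_basis_size (evalm_preim_prime W' N))/(_ hy')/eqP.
by rewrite eqn_add2l => /eqP.
Qed.

(* [rkseq W N = 0] means that [W 0, ..., W (N - 1)] are algebraically independent
   over [R] modulo [Q]. *)
Lemma rkseq0P W N : rkseq W N = 0%N <->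
  forall g : {mpoly R[N]}, evalm_preim W g -> all_mcoeff (fun r => Q (f r)) g.
Proof.
have hq := preim_prime f hQ; have iq := prime_ideal hq.
elim: N => [|N IH].
  split=> // _ g; have -> : g = (meval (fun=> 0) g)%:MP.
    apply: (mpoly_rmorph_ext (f := idfun)
      (g := @mpolyC 0 R \o meval (fun=> 0 : R))) => [c|[]] //=.
    by rewrite mevalC.
  by rewrite /evalm_preim evalmC; apply: all_mcoeffC.
rewrite rkseqS; split.
  move/eqP; rewrite addn_eq0 => /andP [/eqP/IH h0]; rewrite eqb0 => /asboolPn h1 g Qg.
  apply/(all_mcoeff_muni iq) => i; apply: h0; move: i.
  by apply: contrapT => ng; apply: h1; exists g.
move=> h; have -> : rkseq W N = 0%N.
  apply/IH => g Qg; apply/(all_coefC (all_mcoeff_ideal iq N)).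
  rewrite -muniW; apply/(all_mcoeff_muni iq); apply: h.
  by rewrite /evalm_preim evalm_mwiden.
case: asboolP => [[g Qg ng]|_]; last by [].
case: ng => i; have := (all_mcoeff_muni iq g).1 (h _ Qg) i.
apply: (all_mcoeff_min (phi := @evalm W N)); first exact: (prime_ideal hQ).
by move=> c qc; rewrite /= evalmC.
Qed.

End Sequences.

(** * Independent families and strict monotonicity of the rank *)

Section RankComparison.
Variable R : comNzRingType.
Local Notation rkm Q W N := (rkseq (@mpolyC _ R) Q W N).

Lemma rkseq_vars n (Q : {mpoly R[n]} -> Prop) (W : nat -> {mpoly R[n]}) :
  (forall i : 'I_n, W i = 'X_i) -> rkm Q W n = rk Q.
Proof.
move=> hW; congr rk; apply: pred_ext => g; rewrite /evalm_preim.
suff -> : evalm (@mpolyC n R) W g = g by [].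
apply: (mpoly_rmorph_ext (f := @evalm _ _ (@mpolyC n R) W n) (g := idfun)) => [c|i] /=.
  by rewrite evalmC.
by rewrite evalm_var.
Qed.

(** In [W1] the variables come first and generate the ring, so all [k] elements [y] are counted; in
    [W2] the independent [y] come first and contribute nothing, which leaves at most [n]. *)
Lemma independent_bound n (Q : {mpoly R[n]} -> Prop) e (x : 'I_e -> R) (y : nat -> {mpoly R[n]}) k :
  is_prime_ideal Q -> cot_basis (contraction Q) x -> rkm Q y k = 0%N ->
  (k + rk Q <= n)%N.
Proof.
move=> hQ hx y0.
(* The default 0 is not reached by [W1] or [W2] at indices below [k + n]. *)
pose vars i : {mpoly R[n]} := if insub i is Some j then 'X_(j : 'I_n) else 0.
pose W1 i := if (i < n)%N then vars i else y (i - n)%N.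
pose W2 i := if (i < k)%N then y i else vars (i - k)%N.
have W1X (i : 'I_n) : W1 i = 'X_i.
  by rewrite /W1 ltn_ord /vars insubT //= => lti; congr 'X__; apply: val_inj.
have rk1 : rkm Q W1 (k + n) = (k + rk Q)%N.
  rewrite rkseq_generated // ?rkseq_vars // => b; exists b.
  apply: (mpoly_rmorph_ext (f := @evalm _ _ (@mpolyC n R) W1 n) (g := idfun)) => [c|i] /=.
    by rewrite evalmC.
  by rewrite evalm_var.
have rk2 : (rkm Q W2 (n + k) <= n)%N.
  apply: leq_trans (rkseq_addl _ _ _ _ _) _.
  rewrite (eq_rkseq _ _ (W' := y)) ?y0 ?addn0 // => i ltik.
  by rewrite /W2 ltik.
rewrite -rk1; apply: leq_trans rk2; rewrite [(n + k)%N]addnC.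
(* [s] and [t] exchange the block of variables and the block [y]; the default of [insubd] never
   occurs, by [sE] and [tE]. *)
pose s (i : 'I_(k + n)) : 'I_(k + n) := insubd i (if (i < n)%N then i + k else i - n)%N.
pose t (i : 'I_(k + n)) : 'I_(k + n) := insubd i (if (i < k)%N then i + n else i - k)%N.
have sE i : s i = (if (i < n)%N then i + k else i - n)%N :> nat.
  rewrite /s val_insubd; have lti : (i < k + n)%N := ltn_ord i.
  by case: (ltnP i n) => hi; case: ltnP; lia.
have tE i : t i = (if (i < k)%N then i + n else i - k)%N :> nat.
  rewrite /t val_insubd; have lti : (i < k + n)%N := ltn_ord i.
  by case: (ltnP i k) => hi; case: ltnP; lia.
rewrite (rkseq_perm (s := s) (t := t) (W' := W2) hQ hx) //.
- move=> i; apply: val_inj; rewrite /= tE sE; have lti : (i < k + n)%N := ltn_ord i.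
  by case: (ltnP i n) => hi; case: ltnP; lia.
- move=> i; apply: val_inj; rewrite /= sE tE; have lti : (i < k + n)%N := ltn_ord i.
  by case: (ltnP i k) => hi; case: ltnP; lia.
- move=> i; rewrite /W2 sE /W1; have lti : (i < k + n)%N := ltn_ord i.
  case: ltnP => hi; last by rewrite ifT //; lia.
  by rewrite ltnNge leq_addl /= addnK.
Qed.

(** The family consists of the variables that do not count in [rk Q]. *)
Lemma independent_exists n (Q : {mpoly R[n]} -> Prop) :
  is_prime_ideal Q -> exists k y, (k + rk Q = n)%N /\ rkm Q y k = 0%N.
Proof.
elim: n Q => [|n IH] Q hQ; first by exists 0%N, (fun=> 0).
have [k [y [kn y0]]] := IH _ (preim_prime (@mwiden n R) hQ).
have widenE W : (forall i, (i < k)%N -> W i = mwiden (y i)) ->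
    forall g : {mpoly R[k]}, evalm (@mpolyC n.+1 R) W g = mwiden (evalm (@mpolyC n R) y g).
  move=> hW; apply: (mpoly_rmorph_ext (f := @evalm _ _ (@mpolyC n.+1 R) W k)
    (g := @mwiden n R \o @evalm _ _ (@mpolyC n R) y k)) => [c|i] /=.
    by rewrite !evalmC mwidenC.
  by rewrite !evalm_var hW.
have W0 W : (forall i, (i < k)%N -> W i = mwiden (y i)) -> rkm Q W k = 0%N.
  move=> hW; rewrite -y0; congr rk; apply: pred_ext => g.
  by rewrite /evalm_preim (widenE _ hW).
rewrite /=; case: asboolP => he.
  exists k, (fun i => mwiden (y i)); split; first by rewrite addn1 addnS kn.
  exact: W0.
pose W i := if (i < k)%N then mwiden (y i) else 'X_ord_max.
have hW i : (i < k)%N -> W i = mwiden (y i) by rewrite /W => ->.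
exists k.+1, W; split; first by rewrite addn0 addSn kn.
rewrite rkseqS (W0 _ hW); case: asboolP => [[g Qg ng]|_]; last by [].
case: ng => i; rewrite /evalm_preim (widenE _ hW); apply: contrapT => ni; apply: he.
(* Evaluating the relation [g] at the old [y] and the last variable gives an element of [Q] with a
   coefficient outside [Q], so the last variable would have been counted. *)
exists (evalm (@mpolyC n.+1 R) W g) => // h; apply: ni.
have := h i; congr (Q (mwiden _)).
rewrite evalm_muni.
have -> : map_poly (evalm (@mpolyC n.+1 R) W (N:=k)) (muni g) =
    map_poly (@mwiden n R) (map_poly (@evalm _ _ (@mpolyC n R) y k) (muni g)).
  by apply/polyP => j; rewrite !coef_map /= (widenE _ hW).
rewrite /W ltnn -[X in muni X]/(unmuni _) unmuniK coef_map.
by [].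
Qed.

(* If [y] is a maximal independent family of variables modulo [Q'], then
   [y] together with any [f] in [Q'] but not in [Q] is independent modulo [Q]. *)
Lemma rk_lt n (Q Q' : {mpoly R[n]} -> Prop) e (x : 'I_e -> R) :
  is_prime_ideal Q -> is_prime_ideal Q' -> (forall g, Q g -> Q' g) ->
  (exists f, Q' f /\ ~ Q f) -> (forall r, contraction Q' r -> contraction Q r) ->
  cot_basis (contraction Q) x -> (rk Q < rk Q')%N.
Proof.
move=> hQ hQ' sub [f [Q'f nQf]] eqC hx.
have iQ := prime_ideal hQ; have iQ' := prime_ideal hQ'.
have [k [y [kn y0]]] := independent_exists hQ'.
pose W i := if (i < k)%N then y i else f.
have Wy i : (i < k)%N -> W i = y i by rewrite /W => ->.
(* Independence modulo [Q'] puts the coefficients of [g] in the contraction of [Q'], hence in that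
   of [Q]. *)
have Q'Q (g : {mpoly R[k]}) : Q' (evalm (@mpolyC n R) W g) -> Q (evalm (@mpolyC n R) W g).
  rewrite (eq_evalm _ Wy) => Q'g; have := (rkseq0P _ hQ' _ _).1 y0 _ Q'g.
  apply: (all_mcoeff_min (phi := @evalm _ _ (@mpolyC n R) y k)) => // c Q'c.
  by rewrite /= evalmC; apply: eqC.
have W0 : rkm Q W k.+1 = 0%N.
  rewrite rkseqS; have -> : rkm Q W k = 0%N.
    apply/(rkseq0P _ hQ) => g Qg m; apply: eqC.
    apply: ((rkseq0P _ hQ' y k).1 y0 g); apply: sub.
    by rewrite -(eq_evalm _ Wy).
  case: asboolP => [[g Qg ng]|_]; last by [].
  case: ng; move: Qg; rewrite /evalm_preim evalm_muni {2}/W ltnn.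
  (* From [h(f) * f + c] in [Q], and [f] in [Q'], the value of [c] is in [Q'], hence in [Q]; then
     [f] outside [Q] can be cancelled, and the induction continues with [h]. *)
  elim/poly_ind: (muni g) => [|h c IH]; first by move=> _ i; rewrite coef0 rmorph0; apply: (ideal0 iQ).
  rewrite rmorphD rmorphM /= map_polyX map_polyC hornerMXaddC => Qv.
  have Qc : Q (evalm (@mpolyC n R) W c).
    apply: Q'Q; have := sub _ Qv; rewrite addrC => Q'v.
    rewrite -[evalm _ _ _](addrK ((map_poly (evalm (@mpolyC n R) W (N:=k)) h).[f] * f)).
    by apply: (idealB iQ') => //; apply: (ideal_mull iQ').
  apply/all_coefMXaddC; split=> //; apply: IH; apply: (primeMr hQ nQf).
  rewrite -[_ * f](addrK (evalm (@mpolyC n R) W c)).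
  exact: (idealB iQ).
have := independent_bound hQ hx W0; lia.
Qed.

End RankComparison.

(** * Height of a prime with zero contraction *)

Lemma cot_basis_zero (A : comNzRingType) (Q : A -> Prop) (x : 'I_0 -> A) :
  is_prime_ideal Q -> (forall a, Q a -> a = 0) -> cot_basis Q x.
Proof.
move=> hQ Q0; split; [by case | by move=> u c _ _ [] | move=> y /Q0 ->].
exists 1, (fun=> 0); split; first exact: prime1.
rewrite big_ord0 mulr0 subr0; apply: ideal0.
exact: ideal_sq_ideal (prime_ideal hQ).
Qed.

(** All primes of a chain ending at [P] contract to 0, so [rk_lt] applies at each step and gives
    [i <= rk (q i)]; a chain of length [rk P + 1] is impossible. *)
Lemma height_rk (A : comNzRingType) n (P : {mpoly A[n]} -> Prop) :
  is_prime_ideal P -> (forall a, contraction P a -> a = 0) -> has_height P (rk P).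
Proof.
move=> hP P0; split; first exact: chain_to_prime.
move=> [q [[qprime qincr] qP]]; set h := rk P in qprime qincr qP.
have q_sub d i g : (i + d = h.+1)%N -> q i g -> P g.
  elim: d i => [|d IH] i id qg; first by apply/qP; rewrite -id addn0.
  apply: (IH i.+1); first by lia.
  by apply: (qincr i _).1 => //; lia.
have q0 i a : (i <= h.+1)%N -> contraction (q i) a -> a = 0.
  by move=> lei qa; apply: P0; apply: (q_sub (h.+1 - i)%N i); rewrite ?subnKC.
have le_rk i : (i <= h.+1)%N -> (i <= rk (q i))%N.
  elim: i => // i IH lti; apply: leq_ltn_trans (IH (ltnW lti)) _.
  have hqi := qprime i (ltnW lti); have [sub strict] := qincr i lti.
  apply: (rk_lt (x := fun=> 0 : A) (e := 0) hqi (qprime _ lti) sub strict).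
    by move=> r /(q0 _ _ lti) ->; apply: ideal0 (prime_ideal (contraction_prime hqi)).
  apply: cot_basis_zero; first exact: contraction_prime.
  by move=> a; apply: q0; apply: ltnW.
have := le_rk h.+1 (leqnn _).
by rewrite (pred_ext qP) ltnn.
Qed.

(** * The maps to the quotient ring and to the residue field *)

Section QuotientMap.
Variables (B : comNzRingType) (I : B -> Prop) (hI : is_ideal I /\ ~ I 1).

Lemma qpi_zmod : zmod_morphism (qpi hI).
Proof. exact: (rmorphB (\pi_(qring hI))). Qed.

Lemma qpi_monoid : monoid_morphism (qpi hI).
Proof. by split; [exact: (rmorph1 (\pi_(qring hI))) | exact: (rmorphM (\pi_(qring hI)))]. Qed.

HB.instance Definition _ := GRing.isZmodMorphism.Build B (qring hI) (qpi hI) qpi_zmod.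
HB.instance Definition _ := GRing.isMonoidMorphism.Build B (qring hI) (qpi hI) qpi_monoid.

Lemma qpi_eq0 b : qpi hI b = 0 <-> I b.
Proof.
rewrite -(rmorph0 (qpi hI)); split.
  by move/eqP; rewrite -Quotient.idealrBE subr0 => /asboolP.
by move=> Ib; apply/eqP; rewrite -Quotient.idealrBE subr0; apply/asboolP.
Qed.

Lemma qpi_surj z : exists b, qpi hI b = z.
Proof. by exists (repr z); rewrite /qpi reprK. Qed.

End QuotientMap.

Section ResidueMaps.
Variables (A : comNzRingType) (p : A -> Prop) (hp : is_prime_ideal p).

Lemma to_quot_zmod : zmod_morphism (to_quot hp).
Proof. exact: qpi_zmod. Qed.
Lemma to_quot_monoid : monoid_morphism (to_quot hp).
Proof. exact: qpi_monoid. Qed.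
HB.instance Definition _ :=
  GRing.isZmodMorphism.Build A (quot_ring hp) (to_quot hp) to_quot_zmod.
HB.instance Definition _ :=
  GRing.isMonoidMorphism.Build A (quot_ring hp) (to_quot hp) to_quot_monoid.

Lemma to_quot_eq0 r : to_quot hp r = 0 <-> p r.
Proof. exact: qpi_eq0. Qed.

Lemma to_quot_surj z : exists r, to_quot hp r = z.
Proof. exact: qpi_surj. Qed.

Let residue_of_loc : loc hp -> residue_field hp := qpi (locmax_proper hp).

Lemma to_residueE r : to_residue hp r = residue_of_loc (to_loc hp r).
Proof. by []. Qed.

Lemma to_residue_zmod : zmod_morphism (to_residue hp).
Proof. by move=> x y; rewrite !to_residueE rmorphB; apply: qpi_zmod. Qed.
Lemma to_residue_monoid : monoid_morphism (to_residue hp).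
Proof.
split; first by rewrite to_residueE rmorph1; apply: (qpi_monoid _).1.
by move=> x y; rewrite !to_residueE rmorphM; apply: (qpi_monoid _).2.
Qed.
HB.instance Definition _ :=
  GRing.isZmodMorphism.Build A (residue_field hp) (to_residue hp) to_residue_zmod.
HB.instance Definition _ :=
  GRing.isMonoidMorphism.Build A (residue_field hp) (to_residue hp) to_residue_monoid.

Lemma to_residue_eq0 r : to_residue hp r = 0 <-> p r.
Proof. by rewrite -(locmaxP hp); apply: qpi_eq0. Qed.

Lemma to_residue_unit s : ~ p s -> exists t, t * to_residue hp s = 1.
Proof.
move=> /(to_loc_unit hp) [t ht]; exists (residue_of_loc t).
rewrite to_residueE -[RHS](qpi_monoid (locmax_proper hp)).1 -ht.
by symmetry; apply: (qpi_monoid (locmax_proper hp)).2.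
Qed.

Lemma to_residue_frac (z : residue_field hp) :
  exists s r, ~ p s /\ to_residue hp s * z = to_residue hp r.
Proof.
have [y <-] := qpi_surj z; have [s [r [ns e]]] := to_loc_frac y.
exists s, r; split=> //; rewrite [RHS]to_residueE -e.
by symmetry; apply: (qpi_monoid (locmax_proper hp)).2.
Qed.

End ResidueMaps.

(** * The prime [P/p[X]] and its height *)

Section BaseChangeKernel.
Variables (R R' : comNzRingType) (phi : {rmorphism R -> R'}) (n : nat).
Variable P : {mpoly R[n]} -> Prop.
Hypothesis hP : is_prime_ideal P.
Hypothesis phi0 : forall r, phi r = 0 -> contraction P r.

Lemma map_mpoly_eq0_sub g : map_mpoly phi g = 0 -> P g.
Proof.
move=> g0; apply: (all_mcoeff_min (q := contraction P) (phi := idfun)) => //.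
  exact: prime_ideal.
by move=> m; apply: phi0; rewrite -mcoeff_map_mpoly g0 mcoeff0.
Qed.

Lemma map_mpoly_eq_sub g g' : P g' -> map_mpoly phi g = map_mpoly phi g' -> P g.
Proof.
move=> Pg' e; apply: (idealBr (prime_ideal hP) _ Pg'); apply: map_mpoly_eq0_sub.
by rewrite rmorphB /= e subrr.
Qed.

End BaseChangeKernel.

Section QuotPrime.
Variables (R : comNzRingType) (n : nat) (P : {mpoly R[n]} -> Prop).
Hypothesis hP : is_prime_ideal P.
Local Notation hp := (contraction_prime hP).
Let phi : {rmorphism R -> quot_ring hp} := to_quot hp.
Let iP := prime_ideal hP.

Let phi0 r : phi r = 0 -> contraction P r. Proof. by move/to_quot_eq0. Qed.

Lemma quot_primeP g : P g <-> quot_prime hP (map_mpoly phi g).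
Proof.
split=> [Pg|[g' [Pg' e]]]; first by exists g.
exact: (map_mpoly_eq_sub hP phi0 Pg' e).
Qed.

Lemma map_to_quot_surj (f : {mpoly (quot_ring hp)[n]}) : exists g, map_mpoly phi g = f.
Proof.
have [||s [g [-> e]]] := mpoly_denominator (phi := phi) f (S := fun s => s = 1).
- by move=> s t -> ->; rewrite mulr1.
- move=> z; have [r <-] := to_quot_surj z.
  by exists 1, r; rewrite rmorph1 mul1r.
by exists g; rewrite -e rmorph1 mpolyC1 mul1r.
Qed.

Lemma quot_prime_prime : is_prime_ideal (quot_prime hP).
Proof.
split; first split.
- by rewrite -(rmorph0 (map_mpoly phi)); apply/quot_primeP/(ideal0 iP).
- move=> _ _ [g [Pg ->]] [g' [Pg' ->]]; exists (g + g'); split; first exact: (idealD iP).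
  by rewrite -rmorphD.
- move=> a _ [g [Pg ->]]; have [b <-] := map_to_quot_surj a.
  exists (b * g); split; first exact: (ideal_mull iP).
  by rewrite -rmorphM.
- by rewrite -(rmorph1 (map_mpoly phi)) => /quot_primeP; apply: prime1.
- move=> x y; have [a <-] := map_to_quot_surj x; have [b <-] := map_to_quot_surj y.
  rewrite -rmorphM => /quot_primeP /(primeM hP) [] h; [left|right]; exact/quot_primeP.
Qed.

Lemma quot_prime_height : has_height (quot_prime hP) (rk P).
Proof.
rewrite (rk_base_change (phi := phi) quot_prime_prime quot_primeP); last first.
  move=> z; have [r <-] := to_quot_surj z; exists 1, r.
  rewrite rmorph1 mul1r; split=> //; rewrite mpolyC1; exact: prime1 quot_prime_prime.
apply: height_rk; first exact: quot_prime_prime.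
move=> z; have [r <-] := to_quot_surj z; rewrite /contraction.
rewrite -(map_mpolyC n phi) => /quot_primeP Pr.
exact/to_quot_eq0.
Qed.

End QuotPrime.

(** * The prime of the fibre over the residue field *)

Section ExtendedPrime.
Variables (R K : comNzRingType) (phi : {rmorphism R -> K}) (n : nat).
Variable P : {mpoly R[n]} -> Prop.
Hypothesis hP : is_prime_ideal P.
Hypothesis phi0 : forall r, phi r = 0 <-> contraction P r.
Hypothesis phi_unit : forall s, ~ contraction P s -> exists t, t * phi s = 1.
Hypothesis phi_frac : forall z, exists s r, ~ contraction P s /\ phi s * z = phi r.
Let hp := contraction_prime hP.
Let iP := prime_ideal hP.
Let phi0W r : phi r = 0 -> contraction P r. Proof. by move/phi0. Qed.
Let npC s : ~ contraction P s -> ~ P s%:MP. Proof. by []. Qed.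

(** Has the body of [fibre_prime], for any [K] with the above properties of the residue field, so
    the results apply to [fibre_prime] by conversion. *)
Definition extended (f : {mpoly K[n]}) : Prop :=
  exists (k : nat) (h : 'I_k -> {mpoly K[n]}) (g : 'I_k -> {mpoly R[n]}),
    (forall i, P (g i)) /\ f = \sum_(i < k) h i * map_mpoly phi (g i).

Lemma map_mpoly_frac (f : {mpoly K[n]}) :
  exists s g, ~ contraction P s /\ (phi s)%:MP * f = map_mpoly phi g.
Proof.
apply: (mpoly_denominator (phi := phi) f (S := fun s => ~ contraction P s)).
  by move=> s t; apply: (nprimeM hp).
exact: phi_frac.
Qed.

(** The multipliers [h i] have a common denominator outside [p]; conversely such a denominator is
    invertible in [K]. *)
Lemma extendedE f : extended f <->
  exists s g, [/\ ~ contraction P s, P g & (phi s)%:MP * f = map_mpoly phi g].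
Proof.
split; last first.
  move=> [s [g [ns Pg e]]]; have [t ht] := phi_unit ns.
  exists 1%N, (fun=> t%:MP), (fun=> g); split=> //; rewrite big_ord1.
  by rewrite -[map_mpoly _ g]e mulrA -mpolyCM ht mpolyC1 mul1r.
move=> [k [h [g [Pg ->]]]].
elim/big_rec: _ => [|i f' _ [s [b [ns Pb e]]]].
  exists 1, 0; split; [exact: (prime1 hp) | exact: (ideal0 iP) | by rewrite mulr0 rmorph0].
have [t [a [nt et]]] := map_mpoly_frac (h i).
exists (t * s), (s%:MP * (a * g i) + t%:MP * b); split.
- exact: (nprimeM hp).
- by apply: (idealD iP); do ?apply: (ideal_mull iP).
- rewrite rmorphD !rmorphM /= !map_mpolyC /= -et -e ?mpolyCM.
  by rewrite -/phi; ring.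
Qed.

Lemma extendedP g : P g <-> extended (map_mpoly phi g).
Proof.
split=> [Pg|/extendedE [s [b [ns Pb e]]]].
  apply/extendedE; exists 1, g; split=> //; first exact: (prime1 hp).
  by rewrite rmorph1 mpolyC1 mul1r.
apply: (primeMl hP (npC ns)); apply: (map_mpoly_eq_sub hP phi0W Pb).
by rewrite rmorphM /= map_mpolyC.
Qed.

Lemma extended_cancel s f : ~ contraction P s ->
  extended ((phi s)%:MP * f) -> extended f.
Proof.
move=> ns /extendedE [t [g [nt Pg e]]]; apply/extendedE.
exists (t * s), g; split=> //; first exact: (nprimeM hp).
by rewrite rmorphM mpolyCM -mulrA.
Qed.

Lemma extended_ideal : is_ideal (extended).
Proof.
split.
- by rewrite -(rmorph0 (map_mpoly phi)); apply/extendedP/(ideal0 iP).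
- move=> x y /extendedE [s [g [ns Pg e]]] /extendedE [t [g' [nt Pg' e']]].
  apply/extendedE; exists (s * t), (t%:MP * g + s%:MP * g'); split.
  + exact: (nprimeM hp).
  + by apply: (idealD iP); apply: (ideal_mull iP).
  + rewrite rmorphD !rmorphM /= !map_mpolyC /= -e -e' ?mpolyCM.
    by ring.
- move=> a x /extendedE [s [g [ns Pg e]]].
  have [t [b [nt e']]] := map_mpoly_frac a.
  apply/extendedE; exists (t * s), (b * g); split.
  + exact: (nprimeM hp).
  + exact: (ideal_mull iP).
  + by rewrite !rmorphM /= -e -e' ?mpolyCM; ring.
Qed.

Lemma extended_prime : is_prime_ideal (extended).
Proof.
split; first exact: extended_ideal.
  by rewrite -(rmorph1 (map_mpoly phi)) => /extendedP; apply: prime1.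
move=> x y hxy.
have [s [a [ns ea]]] := map_mpoly_frac x.
have [t [b [nt eb]]] := map_mpoly_frac y.
have /extendedP : extended (map_mpoly phi (a * b)).
  rewrite rmorphM /= -ea -eb mulrACA.
  exact: (ideal_mull extended_ideal).
move=> /(primeM hP) [] /extendedP.
  by rewrite -ea => /(extended_cancel ns); left.
by rewrite -eb => /(extended_cancel nt); right.
Qed.

Lemma rk_extended : rk P = rk (extended).
Proof.
apply: (rk_base_change (phi := phi) extended_prime extendedP) => z.
have [s [r [ns e]]] := phi_frac z; exists s, r; split=> //.
by rewrite -(map_mpolyC n phi) => /extendedP.
Qed.

Lemma extended_contraction z : contraction (extended) z -> z = 0.
Proof.
move=> hz; have [s [r [ns e]]] := phi_frac z.
have [t ht] := phi_unit ns.
have r0 : phi r = 0.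
  apply/phi0/extendedP; rewrite map_mpolyC /= -e mpolyCM.
  exact: (ideal_mull extended_ideal).
by rewrite -[z]mul1r -ht -mulrA e [X in _ * X]r0 mulr0.
Qed.

End ExtendedPrime.

Theorem theorem3p1 (R : comNzRingType) (n : nat) (hR : noetherian R)
  (P : {mpoly R[n]} -> Prop) (hP : is_prime_ideal P) :
  exists e1 e2 h e3 : nat,
    [/\ edim_at P e1, edim_at (contraction P) e2, has_height (quot_prime hP) h,
        edim_at (fibre_prime hP) e3 & (e1 = e2 + h)%N /\ (e2 + h = e2 + e3)%N].
Proof.
pose hp := contraction_prime hP.
have [e [x hx]] := cot_basis_exists hp (hR _ (prime_ideal hp)).
have [y hy] := cot_basis_mpoly hP hx.
have phi0 := to_residue_eq0 hp; have unit := @to_residue_unit _ _ hp.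
have frac := @to_residue_frac _ _ hp.
have hF : is_prime_ideal (fibre_prime hP) := extended_prime hP phi0 unit frac.
(* The fibre prime contracts to 0 in the residue field, so its embedding dimension is [0 + rk]. *)
have hF0 : cot_basis (contraction (fibre_prime hP)) (fun _ : 'I_0 => 0).
  apply: cot_basis_zero; first exact: contraction_prime.
  exact: (extended_contraction hP phi0 unit frac).
have [z hz] := cot_basis_mpoly hF hF0.
have rkE : rk P = rk (fibre_prime hP) := rk_extended hP phi0 unit frac.
exists (e + rk P)%N, e, (rk P), (rk P); split=> //.
- exact: edim_cot_basis hy.
- exact: edim_cot_basis hx.
- exact: quot_prime_height.
- by rewrite rkE; apply: edim_cot_basis hz.
Qed.
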